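(* Let $Q$ be a countable torsion free (discrete) abelian group and let $n\in\mathbb N$, $n\ge 1$. (i) The asymmetrization $\mathrm{AS}$ maps the group $\mathrm Z^n(Q,\mathbb T)$ of $\mathbb T$-valued $n$-cocycles onto the compact group $X^n(Q,\mathbb T)$ of all asymmetric multi-characters on $n$ variables of $Q$. (ii) The sequence $$1\longrightarrow \mathrm B^n(Q,\mathbb T)\longrightarrow \mathrm Z^n(Q,\mathbb T)\xrightarrow{\ \mathrm{AS}\ }X^n(Q,\mathbb T)\longrightarrow 1$$ is exact. Consequently, for $Q=\mathbb Z^m$, $\mathrm H^n(\mathbb Z^m,\mathbb T)\cong X^n(\mathbb Z^m,\mathbb T)$, which is isomorphic to $\mathbb T^{\frac{m!}{n!(m-n)!}}$ if $m\ge n$ and is trivial if $m<n$. More generally, for every countable torsion free abelian group $Q$, $\mathrm H^n(Q,\mathbb T)$ is naturally isomorphic to the Pontrjagin--Kampen dual of the $n$-th exterior power $Q\wedge Q\wedge\cdots\wedge Q$ of $Q$. (iii) The group $X^n(Q,\mathbb T)$ is a subgroup of $\mathrm Z^n(Q,\mathbb T)$ such that $$\mathrm Z^n(Q,\mathbb T)=X^n(Q,\mathbb T)\,\mathrm B^n(Q,\mathbb T),\qquad X^n(Q,\mathbb T)\cap \mathrm B^n(Q,\mathbb T)=\{c\in X^n(Q,\mathbb T): c^{n!}=1\},$$ and $\mathrm{AS}\,c=c^{n!}$ for every $c\in X^n(Q,\mathbb T)$.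
   Context: $\mathbb T=\{z\in\mathbb C:|z|=1\}$ is a trivial $Q$-module, written multiplicatively. $\mathrm C^n(Q,\mathbb T)$ is the group of all functions $Q^n\to\mathbb T$ under pointwise multiplication; the coboundary $\partial:\mathrm C^n(Q,\mathbb T)\to \mathrm C^{n+1}(Q,\mathbb T)$ is the usual one of group cohomology, $$(\partial\xi)(g_1,\dots,g_{n+1})=\xi(g_2,\dots,g_{n+1})\prod_{k=1}^n\xi(g_1,\dots,g_kg_{k+1},\dots,g_{n+1})^{(-1)^k}\,\xi(g_1,\dots,g_n)^{(-1)^{n+1}};$$ $\mathrm Z^n$ is its kernel on $\mathrm C^n$, $\mathrm B^n=\partial(\mathrm C^{n-1})$, and $\mathrm H^n=\mathrm Z^n/\mathrm B^n$. The asymmetrization of $\xi\in\mathrm C^n(Q,\mathbb T)$ is $(\mathrm{AS}\,\xi)(g_1,\dots,g_n)=\prod_{\sigma\in S_n}\xi(g_{\sigma(1)},\dots,g_{\sigma(n)})^{\mathrm{sign}(\sigma)}$. A multi-character on $n$ variables is a map $Q^n\to\mathbb T$ which is a homomorphism in each variable separately. It is asymmetric if it is alternating, i.e. equal to $1$ whenever two of its arguments coincide (hence it factors through $Q\wedge\cdots\wedge Q$). $X^n(Q,\mathbb T)$ is the group of these, compact in the topology of pointwise convergence. *)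

(* Defs.v *)
From HB Require Import structures.
From mathcomp.multinomials Require Import freeg.
From mathcomp Require Import all_boot all_order all_algebra all_fingroup.
From mathcomp Require Import generic_quotient ring_quotient complex.
From mathcomp Require Import boolp classical_sets functions cardinality reals.
From mathcomp Require Import topology normedtype.

Set Implicit Arguments.
Unset Strict Implicit.
Unset Printing Implicit Defensive.

Import Order.TTheory GRing.Theory Num.Theory.
Import numFieldNormedType.Exports.

Local Open Scope quotient_scope.
Local Open Scope classical_set_scope.
Local Open Scope complex_scope.
Local Open Scope ring_scope.

(* The circle group.  Abelian groups are zmodTypes, which are additive: the
   zmodType operations + , 0 and - on [circle R] are complex multiplication,
   1 and complex inversion, so that [a *+ k] stands for the power a^k and
   [a *~ (-1)] for a^{-1}. *)
Record circle (R : realType) :=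
  Circle { circle_val : R[i]; circle_norm : `|circle_val| == 1 }.

Section CircleGroup.
Variable R : realType.
Implicit Types z w : circle R.

HB.instance Definition _ := [isSub for @circle_val R].
HB.instance Definition _ := [Choice of circle R by <:].

Let one_norm : `|1 : R[i]| == 1. Proof. by rewrite normr1. Qed.

Let mul_norm z w : `|circle_val z * circle_val w| == 1.
Proof. by rewrite normrM (eqP (circle_norm z)) (eqP (circle_norm w)) mulr1. Qed.

Let inv_norm z : `|(circle_val z)^-1| == 1.
Proof. by rewrite normfV (eqP (circle_norm z)) invr1. Qed.

Definition circle1 : circle R := Circle one_norm.
Definition circle_mul z w : circle R := Circle (mul_norm z w).
Definition circle_inv z : circle R := Circle (inv_norm z).

Let circle_mulA : associative circle_mul.
Proof. by move=> x y z; apply: val_inj; rewrite /= mulrA. Qed.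

Let circle_mulC : commutative circle_mul.
Proof. by move=> x y; apply: val_inj; rewrite /= mulrC. Qed.

Let circle_mul1 : left_id circle1 circle_mul.
Proof. by move=> x; apply: val_inj; rewrite /= mul1r. Qed.

Let circle_mulV : left_inverse circle1 circle_inv circle_mul.
Proof.
move=> x; apply: val_inj; rewrite /= mulVf //.
by rewrite -normr_eq0 (eqP (circle_norm x)) oner_eq0.
Qed.

HB.instance Definition _ := GRing.isZmodule.Build (circle R)
  circle_mulA circle_mulC circle_mul1 circle_mulV.

(* R[i]^o carries the topology of the complex modulus. *)
HB.instance Definition _ := Uniform.copy (circle R)
  (initial_topology (@circle_val R : circle R -> R[i]^o)).

Lemma circle_val_continuous :
  continuous (@circle_val R : circle R -> R[i]^o).
Proof. exact: initial_continuous. Qed.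

Lemma circle_sub_continuous :
  continuous (fun x : circle R * circle R => x.1 - x.2).
Proof.
apply: (@continuous_comp_initial _ _ _ (@circle_val R : circle R -> R[i]^o)).
move=> x; rewrite /comp /=.
apply: (@cvgM R[i]^o).
  by apply: (continuous_comp (g := @circle_val R : circle R -> R[i]^o));
    [exact: cvg_fst|exact: circle_val_continuous].
apply: (@cvgV R[i]^o).
  by rewrite -normr_eq0 (eqP (circle_norm x.2)) oner_eq0.
by apply: (continuous_comp (g := @circle_val R : circle R -> R[i]^o));
  [exact: cvg_snd|exact: circle_val_continuous].
Qed.

HB.instance Definition _ :=
  PreTopologicalNmodule_isTopologicalZmodule.Build (circle R)
    circle_sub_continuous.

End CircleGroup.

Section Cochains.
Variables (R : realType) (Q : zmodType).

Definition cochain (n : nat) : Type := {ffun 'I_n -> Q} -> circle R.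

HB.instance Definition _ n := GRing.Zmodule.on (cochain n).

(* (g_0, ..., g_k + g_{k+1}, ..., g_n) *)
Definition add_adjacent n (k : 'I_n) (g : {ffun 'I_n.+1 -> Q}) : {ffun 'I_n -> Q} :=
  [ffun i : 'I_n => if (i < k)%N then g (lift ord_max i)
                    else if i == k then g (lift ord_max i) + g (lift ord0 i)
                    else g (lift ord0 i)].

Definition cobound n (c : cochain n) : cochain n.+1 := fun g =>
  c [ffun i => g (lift ord0 i)]
  + \sum_(k < n) c (add_adjacent k g) *~ (-1) ^+ k.+1
  + c [ffun i => g (lift ord_max i)] *~ (-1) ^+ n.+1.

Lemma cobound_is_zmod_morphism n : {morph @cobound n : c d / c - d}.
Proof.
move=> c d; apply/funext => g.
have subE (m : nat) (e f : cochain m) x : (e - f) x = e x - f x by [].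
rewrite subE /cobound !subE mulrzBl.
rewrite (eq_bigr (fun k => c (add_adjacent k g) *~ (-1) ^+ k.+1
  - d (add_adjacent k g) *~ (-1) ^+ k.+1));
  last by move=> k _; rewrite subE mulrzBl.
by rewrite sumrB !opprD [RHS]addrACA; congr (_ + _); rewrite [RHS]addrACA.
Qed.

HB.instance Definition _ n := GRing.isZmodMorphism.Build (cochain n)
  (cochain n.+1) (@cobound n) (@cobound_is_zmod_morphism n).

Definition cocycles n : {pred cochain n} := [pred c | cobound c == 0].

(* B^0 is the trivial group. *)
Definition coboundaries n : {pred cochain n} :=
  match n return {pred cochain n} with
  | 0 => [pred c | c == 0]
  | p.+1 => [pred c | `[< exists b : cochain p, c = cobound b >]]
  end.

Definition AS n (c : cochain n) : cochain n := fun g =>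
  \sum_(s : 'S_n) c [ffun i => g (s i)] *~ (-1) ^+ s.

Lemma AS_is_zmod_morphism n : {morph @AS n : c d / c - d}.
Proof.
move=> c d; apply/funext => g.
have subE (m : nat) (e f : cochain m) x : (e - f) x = e x - f x by [].
rewrite subE /AS -sumrB.
by apply: eq_bigr => s _; rewrite subE mulrzBl.
Qed.

HB.instance Definition _ n := GRing.isZmodMorphism.Build (cochain n)
  (cochain n) (@AS n) (@AS_is_zmod_morphism n).

End Cochains.

Arguments cocycles R Q n : clear implicits.
Arguments coboundaries R Q n : clear implicits.
Arguments AS {R Q n} c.

Section MultiAdditive.
Variable Q : zmodType.

Definition upd n (g : {ffun 'I_n -> Q}) (i : 'I_n) (x : Q) : {ffun 'I_n -> Q} :=
  [ffun j => if j == i then x else g j].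

Definition multiadditive (V : zmodType) n (c : {ffun 'I_n -> Q} -> V) :=
  forall (g : {ffun 'I_n -> Q}) (i : 'I_n),
    {morph (fun x => c (upd g i x)) : x y / x + y}.

Definition alternating (V : zmodType) n (c : {ffun 'I_n -> Q} -> V) :=
  forall (g : {ffun 'I_n -> Q}) (i j : 'I_n), i != j -> g i = g j -> c g = 0.

Definition torsion_free := forall (x : Q) (k : nat),
  (0 < k)%N -> x *+ k = 0 -> x = 0.

End MultiAdditive.

Section Groups.
Variables (R : realType) (Q : zmodType) (n : nat).

Definition altchars : {pred cochain R Q n} :=
  [pred c | `[< multiadditive c /\ alternating c >]].

Lemma cocycles_zmod_closed : zmod_closed (cocycles R Q n).
Proof.
have cocyclesE (c : cochain R Q n) : (c \in cocycles R Q n) = (cobound c == 0).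
  by [].
split=> [|c d]; first by rewrite cocyclesE raddf0.
by rewrite !cocyclesE raddfB /= => /eqP-> /eqP->; rewrite subr0.
Qed.

HB.instance Definition _ := GRing.isZmodClosed.Build (cochain R Q n)
  (cocycles R Q n) cocycles_zmod_closed.

Lemma altcharsP (c : cochain R Q n) :
  reflect (multiadditive c /\ alternating c) (c \in altchars).
Proof. exact: asboolP. Qed.

Lemma altchars_zmod_closed : zmod_closed altchars.
Proof.
split=> [|c d].
  by apply/altcharsP; split=> [g i x y|//]; rewrite [RHS]addr0.
move=> /altcharsP[cm ca] /altcharsP[dm da]; apply/altcharsP.
have subE x : (c - d) x = c x - d x by [].
split=> [g i x y /=|g i j ij gij].
  by rewrite !subE cm dm opprD addrACA.
by rewrite subE (ca _ _ _ ij gij) (da _ _ _ ij gij) subr0.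
Qed.

HB.instance Definition _ := GRing.isZmodClosed.Build (cochain R Q n)
  altchars altchars_zmod_closed.

Record cocycle := Cocycle {
  cocycle_val :> cochain R Q n;
  cocycleP : cocycle_val \in cocycles R Q n }.

HB.instance Definition _ := [isSub for cocycle_val].
HB.instance Definition _ := [Choice of cocycle by <:].
HB.instance Definition _ := [SubChoice_isSubZmodule of cocycle by <:].

Record altchar := Altchar {
  altchar_val :> cochain R Q n;
  altcharP : altchar_val \in altchars }.

HB.instance Definition _ := [isSub for altchar_val].
HB.instance Definition _ := [Choice of altchar by <:].
HB.instance Definition _ := [SubChoice_isSubZmodule of altchar by <:].

(* Topology of pointwise convergence. *)
HB.instance Definition _ := Uniform.copy altchar
  (initial_topology
     (altchar_val : altchar -> {ptws {ffun 'I_n -> Q} -> circle R})).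

Lemma altchar_sub_continuous :
  continuous (fun x : altchar * altchar => x.1 - x.2).
Proof.
apply: (@continuous_comp_initial _ _ _
  (altchar_val : altchar -> {ptws {ffun 'I_n -> Q} -> circle R})).
have eval_continuous g :
    continuous (fun x : altchar => altchar_val x g : circle R).
  move=> x; apply: (@continuous_comp altchar
    {ptws {ffun 'I_n -> Q} -> circle R} (circle R) altchar_val (@^~ g)).
    exact: initial_continuous.
  exact: (@proj_continuous _ (fun=> circle R) g).
move=> x0; apply/cvg_sup => g; move: x0.
apply: (@continuous_comp_initial (cochain R Q n) _ _ (@^~ g)) => x.
apply: (@continuous_comp _ _ _
  (fun y : altchar * altchar =>
    (altchar_val y.1 g : circle R, altchar_val y.2 g : circle R))
  (fun z => z.1 - z.2)); last exact: circle_sub_continuous.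
have fst_c : {for x, continuous (fun y : altchar * altchar =>
    altchar_val y.1 g : circle R)}.
  apply: (@continuous_comp _ _ _ fst (fun y : altchar => altchar_val y g)).
    exact: cvg_fst.
  exact: eval_continuous.
have snd_c : {for x, continuous (fun y : altchar * altchar =>
    altchar_val y.2 g : circle R)}.
  apply: (@continuous_comp _ _ _ snd (fun y : altchar => altchar_val y g)).
    exact: cvg_snd.
  exact: eval_continuous.
exact: (cvg_pair fst_c snd_c).
Qed.

HB.instance Definition _ :=
  PreTopologicalNmodule_isTopologicalZmodule.Build altchar
    altchar_sub_continuous.

(* B^n as a subgroup of the type of n-cocycles. *)
Definition cobounding : {pred cocycle} :=
  [pred c | cocycle_val c \in coboundaries R Q n].

End Groups.

Arguments altchars R Q n : clear implicits.
Arguments cobounding R Q n : clear implicits.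

Section Cohomology.
Variables (R : realType) (Q : zmodType) (n : nat).

Lemma coboundaries_zmod_closed : zmod_closed (coboundaries R Q n).
Proof.
case: n => [|p]; split=> [|c d].
- exact: eqxx.
- by move=> /eqP-> /eqP->; apply/eqP; rewrite subrr.
- by apply/asboolP; exists 0; rewrite raddf0.
- move=> /asboolP[b ->] /asboolP[e ->]; apply/asboolP.
  by exists (b - e); rewrite raddfB.
Qed.

HB.instance Definition _ := GRing.isZmodClosed.Build (cochain R Q n)
  (coboundaries R Q n) coboundaries_zmod_closed.

Lemma cobounding_zmod_closed : zmod_closed (cobounding R Q n).
Proof.
split=> [|c d]; first exact: (rpred0 (coboundaries R Q n)).
exact: (@rpredB _ (coboundaries R Q n)).
Qed.

HB.instance Definition _ := GRing.isZmodClosed.Build (cocycle R Q n)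
  (cobounding R Q n) cobounding_zmod_closed.

Definition cohomology : Type := Quotient.quot (cobounding R Q n).

HB.instance Definition _ := GRing.Zmodule.on cohomology.
HB.instance Definition _ := Quotient.on cohomology.

Definition cohomology_class (c : cocycle R Q n) : cohomology :=
  \pi_(Quotient.quot (cobounding R Q n)) c.

End Cohomology.

Section Dual.
Variables (R : realType) (A : zmodType).

Definition characters : {pred A -> circle R} :=
  [pred f | `[< {morph f : x y / x + y} >]].

Lemma charactersP (f : A -> circle R) :
  reflect {morph f : x y / x + y} (f \in characters).
Proof. exact: asboolP. Qed.

Lemma characters_zmod_closed : zmod_closed characters.
Proof.
split=> [|f h /charactersP fD /charactersP hD]; apply/charactersP => x y.
  by rewrite [RHS]addr0.
have subE z : (f - h) z = f z - h z by [].
by rewrite !subE fD hD opprD addrACA.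
Qed.

HB.instance Definition _ := GRing.isZmodClosed.Build (A -> circle R)
  characters characters_zmod_closed.

(* Pontrjagin dual of the discrete group A. *)
Record dual := Dual {
  dual_val :> A -> circle R;
  dualP : dual_val \in characters }.

HB.instance Definition _ := [isSub for dual_val].
HB.instance Definition _ := [Choice of dual by <:].
HB.instance Definition _ := [SubChoice_isSubZmodule of dual by <:].

End Dual.

Section SpanZ.
Variables (V : zmodType) (S : V -> Prop).

Definition spanZ : {pred V} := [pred v | `[< forall P : {pred V},
  zmod_closed P -> (forall s, S s -> s \in P) -> v \in P >]].

Lemma spanZP v : reflect (forall P : {pred V},
  zmod_closed P -> (forall s, S s -> s \in P) -> v \in P) (v \in spanZ).
Proof. exact: asboolP. Qed.

Lemma spanZ_zmod_closed : zmod_closed spanZ.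
Proof.
split=> [|u v /spanZP uS /spanZP vS]; apply/spanZP => P Pz SP.
  by case: Pz.
by case: (Pz) => _; apply; [exact: uS|exact: vS].
Qed.

HB.instance Definition _ := GRing.isZmodClosed.Build V spanZ spanZ_zmod_closed.

End SpanZ.

Lemma spanZ_morph (V W : zmodType) (f : {additive V -> W})
    (S : V -> Prop) (T : W -> Prop) :
  (forall s, S s -> f s \in spanZ T) ->
  forall v, v \in spanZ S -> f v \in spanZ T.
Proof.
move=> fST v /spanZP vS.
apply: (vS [pred u | f u \in spanZ T]) => //.
split=> [|u w]; rewrite ![_ \in [pred _ | _]]unfold_in /=
  ?raddf0 ?raddfB ?rpred0 //.
exact: rpredB.
Qed.

(* The n-th exterior power over Z: the free abelian group on Q^n modulo
   multiadditivity and alternation. *)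
Section ExteriorPower.
Variables (Q : zmodType) (n : nat).

Local Notation freeQ := {freeg {ffun 'I_n -> Q} / int}.

Inductive ext_relator : freeQ -> Prop :=
| ext_relator_add (g : {ffun 'I_n -> Q}) (i : 'I_n) (x y : Q) :
    ext_relator (<< upd g i (x + y) >> - << upd g i x >> - << upd g i y >>)
| ext_relator_alt (g : {ffun 'I_n -> Q}) (i j : 'I_n) :
    i != j -> g i = g j -> ext_relator << g >>.

Definition extpower : Type := Quotient.quot (spanZ ext_relator).

HB.instance Definition _ := GRing.Zmodule.on extpower.
HB.instance Definition _ := Quotient.on extpower.

Definition ext_class (u : freeQ) : extpower :=
  \pi_(Quotient.quot (spanZ ext_relator)) u.

Definition wedge (g : {ffun 'I_n -> Q}) : extpower := ext_class << g >>.

End ExteriorPower.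

Section Functoriality.
Variables (R : realType) (Q Q' : zmodType) (phi : {additive Q -> Q'}) (n : nat).

Definition map_args m (g : {ffun 'I_m -> Q}) : {ffun 'I_m -> Q'} :=
  [ffun i => phi (g i)].

Definition pullback m (c : cochain R Q' m) : cochain R Q m :=
  fun g => c (map_args g).

Lemma pullback_cobound m (c : cochain R Q' m) :
  pullback (cobound c) = cobound (pullback c).
Proof.
apply/funext => g; rewrite /pullback /cobound.
have comp_map p q (f : 'I_p -> 'I_q) (h : {ffun 'I_q -> Q}) :
    [ffun i => map_args h (f i)] = map_args [ffun i => h (f i)].
  by apply/ffunP => i; rewrite !ffunE.
rewrite !comp_map; congr (_ + _ + _); apply: eq_bigr => k _.
congr (c _ *~ _); apply/ffunP => i; rewrite !ffunE.
by case: ifP => // _; case: ifP => // _; rewrite raddfD.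
Qed.

Lemma pullback_is_zmod_morphism m : {morph @pullback m : c d / c - d}.
Proof. by []. Qed.

HB.instance Definition _ m := GRing.isZmodMorphism.Build (cochain R Q' m)
  (cochain R Q m) (@pullback m) (@pullback_is_zmod_morphism m).

Lemma pullback_cocycle_subproof (c : cocycle R Q' n) :
  pullback c \in cocycles R Q n.
Proof.
have /eqP cz : cobound c == 0 := cocycleP c.
by apply/eqP; rewrite -pullback_cobound cz raddf0.
Qed.

Definition pullback_cocycle (c : cocycle R Q' n) : cocycle R Q n :=
  Cocycle (pullback_cocycle_subproof c).

Lemma pullback_coboundary m (e : cochain R Q' m) :
  e \in coboundaries R Q' m -> pullback e \in coboundaries R Q m.
Proof.
case: m e => [|p] e; first by move=> /eqP ->; apply/eqP; rewrite raddf0.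
by move=> /asboolP[b ->]; apply/asboolP; exists (pullback b);
  exact: pullback_cobound.
Qed.

Lemma pullback_cocycleB (c d : cocycle R Q' n) :
  pullback_cocycle (c - d) = pullback_cocycle c - pullback_cocycle d.
Proof. by apply: val_inj; rewrite raddfB. Qed.

Definition cohomology_map (x : cohomology R Q' n) : cohomology R Q n :=
  cohomology_class (pullback_cocycle (repr x)).

Lemma cohomology_map_class (c : cocycle R Q' n) :
  cohomology_map (cohomology_class c) = cohomology_class (pullback_cocycle c).
Proof.
apply/eqP; rewrite -Quotient.idealrBE.
rewrite -pullback_cocycleB.
have dB : repr (cohomology_class c) - c \in cobounding R Q' n.
  by rewrite Quotient.idealrBE; apply/eqP; exact: reprK.
move: (_ - _) dB => e eB; exact: (@pullback_coboundary n (cocycle_val e)).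
Qed.

Definition map_free : {freeg {ffun 'I_n -> Q} / int} ->
    {freeg {ffun 'I_n -> Q'} / int} :=
  fglift (fun g => << map_args g >>).

Lemma map_free_is_zmod_morphism : {morph map_free : u v / u - v}.
Proof. exact: lift_is_additive. Qed.

HB.instance Definition _ := GRing.isZmodMorphism.Build _ _ map_free
  map_free_is_zmod_morphism.

Lemma map_free_gen g : map_free << g >> = << map_args g >>.
Proof. by rewrite /map_free liftU scale1r. Qed.

Definition ext_map (x : extpower Q n) : extpower Q' n :=
  ext_class (map_free (repr x)).

Lemma map_free_relator u : u \in spanZ (@ext_relator Q n) ->
  map_free u \in spanZ (@ext_relator Q' n).
Proof.
apply: spanZ_morph => {u} u.
have updE (g : {ffun 'I_n -> Q}) i x :
    map_args (upd g i x) = upd (map_args g) i (phi x).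
  by apply/ffunP => j; rewrite !ffunE; case: ifP.
move=> [g i x y|g i j ij gij]; apply/spanZP => T _; apply.
  by rewrite !raddfB /= !map_free_gen !updE raddfD; constructor.
rewrite /= map_free_gen.
by apply: (ext_relator_alt ij); rewrite !ffunE gij.
Qed.

Lemma ext_map_class u : ext_map (ext_class u) = ext_class (map_free u).
Proof.
apply/eqP; rewrite -Quotient.idealrBE -raddfB.
apply: map_free_relator; rewrite Quotient.idealrBE; apply/eqP.
exact: reprK.
Qed.

Lemma ext_map_wedge g : ext_map (wedge g) = wedge (map_args g).
Proof. by rewrite /wedge ext_map_class map_free_gen. Qed.

End Functoriality.

(* Main.v *)
(** A cochain [c] on [Q] is turned into the translation-invariant function
    [homog c] of sequences, [homog c (x0 :: .. :: xn) = c (x1 - x0, .., xn - x(n-1))],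
    whose coboundary is the recursive operator [del].  Prism operators then give:
    the slant product by [t], i.e. the signed sum of the insertions of [t] among
    the arguments, anticommutes with the coboundary and is additive in [t] up to
    coboundaries.  As [AS c] is the iterated slant product of [c], [AS] kills
    coboundaries and maps cocycles to alternating multi-characters.

    Conversely a cocycle with [AS c = 0] is a coboundary.  On [A + Z t] it is enough
    that the restrictions to [A] of [c] and of its slant product by [t] are
    coboundaries, so Z^m follows by induction.  For [Q] torsion free, every finite
    subset lies in a copy of some Z^m, so any finite set of the equations
    [cobound b g = c g] in the unknown [b] is solvable, and Tychonoff's theorem
    solves them all at once.  The same argument makes the group of alternating
    multi-characters divisible, since on Z^m it is a torus; dividing by n! then
    yields the surjectivity of [AS] and the decomposition of cocycles. *)

Require Import Defs.
From HB Require Import structures.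
From mathcomp.multinomials Require Import freeg.
From mathcomp Require Import all_boot all_order all_algebra all_fingroup.
From mathcomp Require Import generic_quotient ring_quotient complex.
From mathcomp Require Import boolp classical_sets functions cardinality reals.
From mathcomp Require Import topology normedtype.
From mathcomp Require Import zify ring lra.

Set Implicit Arguments.
Unset Strict Implicit.
Unset Printing Implicit Defensive.

Import Order.TTheory GRing.Theory Num.Theory.
Import numFieldNormedType.Exports.

Local Open Scope quotient_scope.
Local Open Scope classical_set_scope.
Local Open Scope ring_scope.

(** * Cochains on sequences and prism operators *)

(* Proves linear identities in abelian groups: the terms of [a - b] are flattened
   and each pair of opposite terms is moved to the end and cancelled.  The
   instances are matched separately as they may differ up to conversion. *)
Ltac to_last x := repeat match goal with
  | |- context [@Algebra.add _ (@Algebra.add _ ?a x) ?y] =>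
      assert_fails (constr_eq x y); rewrite (addrAC a x y) end.
Ltac zmod_eq :=
  apply: subr0_eq; rewrite -[LHS]add0r !(opprD, opprK, oppr0, addr0, addrA);
  repeat match goal with
  | |- context [@Algebra.add _ ?a (@Algebra.opp ?U ?x)] =>
     to_last x; to_last (@Algebra.opp U x); first [rewrite addrK | rewrite subrK]
  end; reflexivity.

Section SequenceCochains.
Variable V : zmodType.

(** The simplicial coboundary, the alternating sum over the deletions of one entry. Recursion on the
    sequence, with [C] varying, turns the identities below into short inductions. *)
Fixpoint del (X : Type) (C : seq X -> V) (s : seq X) : V :=
  if s is x :: r then C r - del (fun u => C (x :: u)) r else 0.

(** The homotopy between the maps induced by [f] and [f']: its k-th term is C(f x0, .., f xk, f' xk,
    .., f' xn) with sign (-1)^k. *)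
Fixpoint prism (X Y : Type) (f f' : X -> Y) (C : seq Y -> V) (s : seq X) : V :=
  if s is x :: r then C (f x :: f' x :: map f' r)
    - prism f f' (fun u => C (f x :: u)) r else 0.

(** The second order homotopy: terms C(f x0, .., f xk, f' xk, .., f' xl, f'' xl, .., f'' xn) for k
    <= l, with sign (-1)^(k + l). *)
Fixpoint prism2 (X Y : Type) (f f' f'' : X -> Y) (C : seq Y -> V) (s : seq X) : V :=
  if s is x :: r then prism f' f'' (fun u => C (f x :: u)) s
    + prism2 f f' f'' (fun u => C (f x :: u)) r else 0.

Lemma prism2_cons (X Y : Type) (f f' f'' : X -> Y) (C : seq Y -> V) x s :
  prism2 f f' f'' C (x :: s) = prism f' f'' (fun u => C (f x :: u)) (x :: s)
    + prism2 f f' f'' (fun u => C (f x :: u)) s.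
Proof. by []. Qed.

Lemma eq_del (X : Type) (C D : seq X -> V) : C =1 D -> del C =1 del D.
Proof. by move=> /funext->. Qed.

Lemma delB (X : Type) (C D : seq X -> V) s :
  del (fun u => C u - D u) s = del C s - del D s.
Proof.
elim: s C D => [|x s IH] C D /=; first by rewrite subrr.
by rewrite IH !opprD !opprK addrACA.
Qed.

Lemma del0 (X : Type) (s : seq X) : del (fun=> 0 : V) s = 0.
Proof. by elim: s => [|x s IH] //=; rewrite IH subr0. Qed.

Lemma delN (X : Type) (C : seq X -> V) s : del (fun u => - C u) s = - del C s.
Proof.
by elim: s C => [|x s IH] C /=; rewrite ?oppr0 // IH opprB opprK addrC.
Qed.

Lemma delD (X : Type) (C D : seq X -> V) s :
  del (fun u => C u + D u) s = del C s + del D s.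
Proof.
by elim: s C D => [|x s IH] C D /=; rewrite ?addr0 // IH opprD addrACA.
Qed.

Lemma prismB (X Y : Type) (f f' : X -> Y) (C D : seq Y -> V) s :
  prism f f' (fun u => C u - D u) s = prism f f' C s - prism f f' D s.
Proof.
elim: s C D => [|x s IH] C D /=; first by rewrite subrr.
by rewrite IH !opprD !opprK addrACA.
Qed.

Lemma prism0 (X Y : Type) (f f' : X -> Y) s : prism f f' (fun=> 0 : V) s = 0.
Proof. by elim: s => [|x s IH] //=; rewrite IH subr0. Qed.

Lemma prism2B (X Y : Type) (f f' f'' : X -> Y) (C D : seq Y -> V) s :
  prism2 f f' f'' (fun u => C u - D u) s =
  prism2 f f' f'' C s - prism2 f f' f'' D s.
Proof.
elim: s C D => [|x s IH] C D; first by rewrite subrr.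
rewrite !prism2_cons IH.
have -> := prismB f' f'' (fun u => C (f x :: u)) (fun u => D (f x :: u)) (x :: s).
zmod_eq.
Qed.

Lemma prism20 (X Y : Type) (f f' f'' : X -> Y) s :
  prism2 f f' f'' (fun=> 0 : V) s = 0.
Proof.
elim: s => [|x s IH] //; by rewrite prism2_cons IH prism0 addr0.
Qed.

Lemma del_map (X Y : Type) (f : X -> Y) (C : seq Y -> V) s :
  del C (map f s) = del (fun u => C (map f u)) s.
Proof. by elim: s C => [|x s IH] C //=; rewrite IH. Qed.

Lemma prism_map (X Y Z : Type) (f f' : Y -> Z) (g : X -> Y) (C : seq Z -> V) s :
  prism f f' C (map g s) = prism (f \o g) (f' \o g) C s.
Proof. by elim: s C => [|x s IH] C //=; rewrite IH -map_comp. Qed.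

Lemma prism_comp (X Y Z : Type) (f f' : X -> Y) (g : Y -> Z) (C : seq Z -> V) s :
  prism (g \o f) (g \o f') C s = prism f f' (fun u => C (map g u)) s.
Proof. by elim: s C => [|x s IH] C //=; rewrite IH map_comp. Qed.

Lemma del_del (X : Type) (C : seq X -> V) s : del (del C) s = 0.
Proof.
elim: s C => [|x s IH] C //=.
by rewrite (delB C) IH subr0 subrr.
Qed.

(** The homotopy formula of a prism: the inner faces cancel in pairs and the two ends remain. *)
Lemma del_prism (X Y : Type) (f f' : X -> Y) (C : seq Y -> V) s :
  del (prism f f' C) s + prism f f' (del C) s = C (map f' s) - C (map f s).
Proof.
elim: s C => [|x s IH] C /=; first by rewrite subrr addr0.
rewrite (delB (fun u => C (f x :: f' x :: map f' u))) (prismB f f' C).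
have := IH (fun u => C (f x :: u)).
rewrite -(del_map f' (fun u => C (f x :: f' x :: u))) => /eqP.
rewrite addrC eq_sym -subr_eq => /eqP <-; zmod_eq.
Qed.

(** Going from [f] to [f'] and then to [f''] agrees with going directly, up to the homotopy
    [prism2]; this is what makes slant products additive in [t]. *)
Lemma del_prism2 (X Y : Type) (f f' f'' : X -> Y) (C : seq Y -> V) s :
  prism2 f f' f'' (del C) s - del (prism2 f f' f'' C) s =
  prism f f' C s + prism f' f'' C s - prism f f'' C s.
Proof.
elim: s C => [|x s IH] C; first by rewrite /= !(subr0, addr0).
rewrite prism2_cons (prismB f' f'' C) (prism2B f f' f'' C).
set D := fun u => C (f x :: u).
rewrite [del _ (x :: s)]/=.
rewrite (delD (fun u => prism f' f'' D (x :: u))).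
have IHD := IH D; have E := del_prism f' f'' D (x :: s).
have {E}-> : prism f' f'' (del D) (x :: s) = D (f'' x :: map f'' s)
   - D (f' x :: map f' s) - del (prism f' f'' D) (x :: s).
  by rewrite -E; zmod_eq.
have {IHD}-> : prism2 f f' f'' (del D) s = prism f f' D s + prism f' f'' D s
   - prism f f'' D s + del (prism2 f f' f'' D) s.
  by rewrite -IHD; zmod_eq.
rewrite /= -/D /D; zmod_eq.
Qed.

Lemma prism2_map (X Y Z : Type) (f f' f'' : Y -> Z) (g : X -> Y)
    (C : seq Z -> V) s :
  prism2 f f' f'' C (map g s) = prism2 (f \o g) (f' \o g) (f'' \o g) C s.
Proof.
elim: s C => [|x s IH] C //.
by rewrite map_cons !prism2_cons IH -(map_cons g x s) (prism_map f' f'').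
Qed.

Lemma prism2_comp (X Y Z : Type) (f f' f'' : X -> Y) (g : Y -> Z)
    (C : seq Z -> V) s :
  prism2 (g \o f) (g \o f') (g \o f'') C s =
  prism2 f f' f'' (fun u => C (map g u)) s.
Proof.
elim: s C => [|x s IH] C //.
by rewrite !prism2_cons IH (prism_comp f' f'' g (fun u => C (g (f x) :: u))).
Qed.

Lemma eq_del_size (X : Type) (C D : seq X -> V) s :
  (forall u, (size u).+1 = size s -> C u = D u) -> del C s = del D s.
Proof.
elim: s C D => [|x s IH] C D CD //=; rewrite CD //; congr (_ - _).
by apply: IH => u us; apply: CD; rewrite /= us.
Qed.

End SequenceCochains.

(** * Homogeneous cochains and slant products *)

Section SumForms.
Variable V : zmodType.

Lemma del_sum (X : Type) (C : seq X -> V) s :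
  del C s = \sum_(k < size s) C (take k s ++ drop k.+1 s) *~ (-1) ^+ k.
Proof.
elim: s C => [|x s IH] C /=; first by rewrite big_ord0.
rewrite big_ord_recl /= drop0 IH -sumrN; congr (_ + _).
by apply: eq_bigr => k _; rewrite exprS mulN1r mulrNz.
Qed.

Lemma prism_sum (X Y : Type) (f f' : X -> Y) (C : seq Y -> V) s :
  prism f f' C s =
  \sum_(k < size s) C (map f (take k.+1 s) ++ map f' (drop k s)) *~ (-1) ^+ k.
Proof.
elim: s C => [|x s IH] C /=; first by rewrite big_ord0.
rewrite big_ord_recl /= take0 IH -sumrN; congr (_ + _).
by apply: eq_bigr => k _; rewrite exprS mulN1r mulrNz.
Qed.

End SumForms.

Lemma nth_delete (X : Type) (x0 : X) s k i : (k < size s)%N ->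
  nth x0 (take k s ++ drop k.+1 s) i = nth x0 s (bump k i).
Proof.
move=> ks; rewrite nth_cat size_take ks nth_drop /bump.
have [ik|ki] := ltnP i k; first by rewrite nth_take // add0n.
by congr nth; lia.
Qed.

Section Homogeneous.
Variables (R : realType) (Q : zmodType).
Local Notation V := (circle R).

(* Extension by 0 to the other lengths makes [homog_cobound] and [homog_slant]
   hold for all sequences. *)
Definition homog n (c : cochain R Q n) (s : seq Q) : V :=
  if size s == n.+1 then c [ffun i : 'I_n => s`_i.+1 - s`_i] else 0.

(** The vertices of the path from 0 with successive steps [g]. *)
Definition psums n (g : {ffun 'I_n -> Q}) : seq Q :=
  mkseq (fun k => \sum_(i < n | (i < k)%N) g i) n.+1.

Definition dehomog n (C : seq Q -> V) : cochain R Q n := fun g => C (psums g).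

Arguments dehomog n C : clear implicits.

Definition invariant (C : seq Q -> V) :=
  forall t s, C (map (+%R t) s) = C s.

Lemma size_psums n (g : {ffun 'I_n -> Q}) : size (psums g) = n.+1.
Proof. exact: size_mkseq. Qed.

Lemma psumsE n (g : {ffun 'I_n -> Q}) k : (k <= n)%N ->
  (psums g)`_k = \sum_(i < n | (i < k)%N) g i.
Proof. by move=> kn; rewrite nth_mkseq. Qed.

Lemma psums_diff n (g : {ffun 'I_n -> Q}) (i : 'I_n) :
  (psums g)`_i.+1 - (psums g)`_i = g i.
Proof.
rewrite !psumsE // 1?ltnW // (bigD1 i) //= -addrA.
rewrite [X in _ + (X - _)](eq_bigl (fun j : 'I_n => (j < i)%N)).
  by rewrite subrr addr0.
by move=> j; rewrite ltnS -val_eqE /= ltn_neqAle andbC.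
Qed.

Lemma homogK n (c : cochain R Q n) : dehomog n (homog c) = c.
Proof.
apply/funext => g; rewrite /dehomog /homog size_psums eqxx; congr (c _).
by apply/ffunP => i; rewrite ffunE psums_diff.
Qed.

Lemma homog_inj n : injective (@homog n).
Proof. exact: can_inj (@homogK n). Qed.

Lemma homog_inv n (c : cochain R Q n) : invariant (homog c).
Proof.
move=> t s; rewrite /homog size_map; case: eqP => // sn; congr (c _).
apply/ffunP => i; rewrite !ffunE.
by rewrite !(nth_map 0) ?sn ?ltnS // 1?ltnW // opprD addrACA subrr add0r.
Qed.

(** Translated so as to start at 0, [s] is the sequence of partial sums of its differences. *)
Lemma dehomogK n (C : seq Q -> V) s : invariant C -> size s = n.+1 ->
  homog (dehomog n C) s = C s.
Proof.
move=> Cinv sn; rewrite /homog sn eqxx /dehomog -[RHS](Cinv (- s`_0)).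
congr (C _); apply: (@eq_from_nth _ 0).
  by rewrite size_psums size_map.
move=> k; rewrite size_psums => kn.
rewrite psumsE // (nth_map 0) ?sn // addrC.
under eq_bigr do rewrite ffunE.
rewrite -(big_ord_widen n (fun i => s`_i.+1 - s`_i) kn).
by rewrite -(big_mkord xpredT (fun i => s`_i.+1 - s`_i)) telescope_sumr.
Qed.

(** Deleting an inner vertex adds two adjacent differences, as in [add_adjacent]; deleting an end
    vertex drops the first or the last argument. *)
Lemma homog_cobound n (c : cochain R Q n) s :
  homog (cobound c) s = del (homog c) s.
Proof.
rewrite del_sum {1}/homog; case: (eqVneq (size s) n.+2) => sn; last first.
  (* When [s] has the wrong length so have its faces, and both sides vanish. *)
  rewrite big1 // => k _; rewrite /homog size_cat size_takel 1?ltnW //.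
  rewrite size_drop; case: eqP => [E|_]; last by rewrite mul0rz.
  by case/eqP: sn; move: (ltn_ord k) E; lia.
have term (k : 'I_(size s)) : homog c (take k s ++ drop k.+1 s) =
    c [ffun i : 'I_n => s`_(bump k i.+1) - s`_(bump k i)].
  rewrite /homog size_cat size_takel 1?ltnW // size_drop.
  have -> : (k + (size s - k.+1))%N = n.+1 by have := ltn_ord k; lia.
  by rewrite eqxx; congr (c _); apply/ffunP => i; rewrite !ffunE !nth_delete.
under eq_bigr do rewrite term.
rewrite sn big_ord_recl big_ord_recr /= addrA /cobound.
congr (_ + _ + _).
- by congr (c _); apply/ffunP => i; rewrite !ffunE /=.
- apply: eq_bigr => k _; congr (c _ *~ _); apply/ffunP => i; rewrite !ffunE /=.
  rewrite /bump /= [(n <= i)%N]leqNgt ltn_ord /= !add0n -val_eqE /=.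
  case: ltngtP => [ik|ki|->]; rewrite !add1n ltnS.
  + by rewrite leqNgt ik.
  + by rewrite (ltnW ki).
  + by rewrite leqnn add1n; zmod_eq.
- congr (c _ *~ _); apply/ffunP => i; rewrite !ffunE /= /bump.
  have [-> ->] : ((n <= i) = false)%N /\ ((n < i) = false)%N.
    by have := ltn_ord i; lia.
  by rewrite leq0n add1n ltnS leqNgt ltn_ord.
Qed.

(** [unlift k i] is [None] exactly for [i = k], so the k-th term has [t] inserted as argument k. *)
Definition slant n (t : Q) (c : cochain R Q n.+1) : cochain R Q n := fun g =>
  \sum_(k < n.+1) c [ffun i => oapp g t (unlift k i)] *~ (-1) ^+ k.

(** With [t] inserted as argument k, the path follows [s] up to its vertex k, steps by [t] and goes
    on along the translate of [s]. *)
Lemma homog_slant n t (c : cochain R Q n.+1) s :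
  homog (slant t c) s = prism id (+%R t) (homog c) s.
Proof.
rewrite prism_sum {1}/homog; case: (eqVneq (size s) n.+1) => sn; last first.
  rewrite big1 // => k _; rewrite map_id /homog size_cat size_map size_takel //.
  rewrite size_drop; case: eqP => [E|_]; last by rewrite mul0rz.
  by have := ltn_ord k; rewrite /= in E *; move: (nat_of_ord k) E sn => j; lia.
rewrite /slant sn; apply: eq_bigr => k _; congr (_ *~ _).
have kn := ltn_ord k.
rewrite map_id /homog size_cat size_map size_takel ?sn // size_drop.
have -> : (k.+1 + (size s - k))%N = n.+2 by rewrite sn; lia.
rewrite eqxx; congr (c _); apply/ffunP => i; rewrite !ffunE.
have nthE j : (j <= n.+1)%N -> (take k.+1 s ++ [seq t + x | x <- drop k s])`_j =
    if (j <= k)%N then s`_j else t + s`_j.-1.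
  move=> jn; rewrite nth_cat size_takel ?sn // ltnS; case: ifP => jk.
    by rewrite nth_take.
  rewrite (nth_map 0) ?size_drop ?sn; last by lia.
  by rewrite nth_drop; congr (t + _`_ _); lia.
have iS : (i < n.+1)%N := ltn_ord i.
rewrite (nthE i (ltnW iS)) (nthE i.+1 iS).
case: unliftP => [j ->|->] /=.
  rewrite !ffunE /= /bump; case: (leqP k j) => [kj|jk].
    rewrite add1n [(j.+2 <= k)%N]leqNgt ltnS (leqW kj) [(j.+1 <= k)%N]leqNgt ltnS kj /=.
    zmod_eq.
  by rewrite add0n jk (ltnW jk).
by rewrite ltnn leqnn addrK.
Qed.

End Homogeneous.

Arguments dehomog {R Q} n C.

(** * Cocycles, coboundaries and slant products *)

Section Coboundaries.
Variables (R : realType) (Q : zmodType).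
Local Notation V := (circle R).

Lemma cochainBE n (c d : cochain R Q n) g : (c - d) g = c g - d g.
Proof. by []. Qed.

Lemma homogB n (c d : cochain R Q n) s :
  homog (c - d) s = homog c s - homog d s.
Proof. by rewrite /homog; case: eqP => // _; rewrite subr0. Qed.

Lemma homog0 n s : homog (0 : cochain R Q n) s = 0.
Proof. by rewrite /homog if_same. Qed.

(** Uniform in the degree: in degree 0 the equation makes [c] equal to [F [::]], so [F [::] = 0]
    encodes the triviality of B^0. *)
Lemma coboundariesP n (c : cochain R Q n) :
  c \in coboundaries R Q n <->
  exists F : seq Q -> V, [/\ invariant F, F [::] = 0 & homog c =1 del F].
Proof.
split=> [|[F [Finv F0 cF]]].
  case: n c => [c /eqP ->|p c /asboolP[b ->]].
    by exists (fun=> 0); split=> // s; rewrite /homog if_same del0.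
  exists (homog b); split=> [||s]; [exact: homog_inv|by []|exact: homog_cobound].
case: n c cF => [|p] c cF.
  apply/eqP/funext => g; rewrite -(homogK c) /dehomog cF.
  by case: (psums g) (size_psums g) => [|x []] //=; rewrite F0 subr0.
apply/asboolP; exists (dehomog p F); apply: homog_inj; apply/funext => s.
rewrite homog_cobound cF; case: (eqVneq (size s) p.+2) => [sn|sn].
  (* [del F s] reads [F] only on sequences of length [p.+1], where [dehomogK] recovers it. *)
  by apply: eq_del_size => u us; rewrite dehomogK //; move: us; rewrite sn => -[].
rewrite -cF -homog_cobound.
by rewrite /homog (negPf sn).
Qed.

Lemma cocyclesP n (c : cochain R Q n) :
  c \in cocycles R Q n <-> forall s, del (homog c) s = 0.
Proof.
split=> [/(@eqP _ (cobound c)) c0 s|c0].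
  by rewrite -homog_cobound c0 homog0.
by apply/(@eqP _ (cobound c))/homog_inj/funext => s; rewrite homog_cobound c0 homog0.
Qed.

Lemma coboundaries_sub_cocycles n :
  {subset coboundaries R Q n <= cocycles R Q n}.
Proof.
move=> c /coboundariesP[F [_ _ cF]]; apply/cocyclesP => s.
by rewrite (eq_del cF) del_del.
Qed.

Lemma slant_is_zmod_morphism n t : {morph @slant R Q n t : c d / c - d}.
Proof.
move=> c d; apply/funext => g; rewrite cochainBE /slant -sumrB.
by apply: eq_bigr => k _; rewrite cochainBE mulrzBl.
Qed.

HB.instance Definition _ n t := GRing.isZmodMorphism.Build (cochain R Q n.+1)
  (cochain R Q n) (@slant R Q n t) (@slant_is_zmod_morphism n t).

(** Translation by [t] and the identity agree on invariant functions, so the homotopy formula for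
    the prism between them has right-hand side 0. *)
Lemma slant_cobound n t (c : cochain R Q n.+1) :
  slant t (cobound c) = - cobound (slant t c).
Proof.
apply: homog_inj; apply/funext => s.
rewrite -[- _]sub0r homogB homog_slant homog_cobound.
have -> : prism id (+%R t) (homog (cobound c)) s =
          prism id (+%R t) (del (homog c)) s.
  by congr (prism _ _ _ s); apply/funext => u; rewrite homog_cobound.
have := del_prism id (+%R t) (homog c) s.
rewrite map_id homog_inv subrr addrC => /(canRL (addrK _)) ->.
rewrite homog0; congr (0 - _).
by apply: eq_del => u; rewrite homog_slant.
Qed.

Lemma slant_cocycle n t (c : cochain R Q n.+1) :
  c \in cocycles R Q n.+1 -> slant t c \in cocycles R Q n.
Proof.
move=> /eqP c0; apply/eqP.
have := slant_cobound t c; rewrite c0 raddf0 => /eqP.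
by rewrite eq_sym oppr_eq0 => /eqP.
Qed.

Lemma prism_inv (C : seq Q -> V) t t' : invariant C ->
  invariant (prism (+%R t) (+%R t') C).
Proof.
move=> Cinv u s; rewrite prism_map.
have E v : +%R v \o +%R u = +%R u \o +%R v :> (Q -> Q).
  by apply/funext => x /=; rewrite addrCA.
rewrite !E prism_comp; congr (prism _ _ _ s).
by apply/funext => w; exact: Cinv.
Qed.

Lemma prism2_inv (C : seq Q -> V) t t' t'' : invariant C ->
  invariant (prism2 (+%R t) (+%R t') (+%R t'') C).
Proof.
move=> Cinv u s; rewrite prism2_map.
have E v : +%R v \o +%R u = +%R u \o +%R v :> (Q -> Q).
  by apply/funext => x /=; rewrite addrCA.
rewrite !E prism2_comp; congr (prism2 _ _ _ _ s).
by apply/funext => w; exact: Cinv.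
Qed.

(** The primitive is the second order prism for the translations by 0, [t] and [t + t']; by
    invariance the prism from [t] to [t + t'] equals the one from 0 to [t']. *)
Lemma slantD n t t' (c : cochain R Q n.+1) : c \in cocycles R Q n.+1 ->
  slant (t + t') c - slant t c - slant t' c \in coboundaries R Q n.
Proof.
move=> /cocyclesP c0; apply/coboundariesP.
have id0 : id = +%R 0 :> (Q -> Q) by apply/funext => x; rewrite add0r.
exists (prism2 (+%R 0) (+%R t) (+%R (t + t')) (homog c)); split=> //.
  by apply: prism2_inv; exact: homog_inv.
move=> s; have := del_prism2 (+%R 0) (+%R t) (+%R (t + t')) (homog c) s.
have -> : del (homog c) = fun=> 0 by apply/funext.
rewrite prism20 sub0r => /(canRL opprK) ->.
rewrite !homogB !homog_slant id0.
have -> : prism (+%R t) (+%R (t + t')) (homog c) s = prism (+%R 0) (+%R t') (homog c) s.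
  rewrite -[RHS](prism_inv _ _ (homog_inv c) t) prism_map.
  congr (prism _ _ _ s); apply/funext => x /=; first by rewrite add0r.
  by rewrite addrA [t' + t]addrC.
zmod_eq.
Qed.

End Coboundaries.

(** * Asymmetrization *)

Section Asymmetrization.
Variables (R : realType) (Q : zmodType).

(** A permutation amounts to the position sent to 0 and a permutation of the rest; injectivity
    suffices, as both sides have (n+1)! elements. *)
Lemma lift_perm_bij n :
  bijective (fun p : 'I_n.+1 * 'S_n => lift_perm p.1 ord0 p.2).
Proof.
apply: inj_card_bij => [[k s] [k' s'] /= E|].
  have kk' : k = k'.
    by apply: (@perm_inj _ (lift_perm k ord0 s)); rewrite [in RHS]E !lift_perm_id.
  rewrite -kk' in E *; congr pair; apply/permP => i; apply: (@lift_inj _ ord0).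
  by rewrite -!(lift_perm_lift k) E.
by rewrite card_prod !card_Sn card_ord factS.
Qed.

(** Sorts the permutations by the position k that receives the first argument, which contributes the
    sign (-1)^k. *)
Lemma AS_slant n (c : cochain R Q n.+1) g :
  AS c g = AS (slant (g ord0) c) [ffun k => g (lift ord0 k)].
Proof.
rewrite /AS; under [RHS]eq_bigr do rewrite /slant mulrz_suml.
rewrite exchange_big pair_big (reindex _ (onW_bij _ (lift_perm_bij n))) /=.
apply: eq_bigr => -[k s] _ /=.
rewrite odd_lift_perm /= -mulrzA -[(-1) ^+ k]signr_odd -signr_addb addbF.
congr (c _ *~ _); apply/ffunP => i; rewrite !ffunE.
by case: (unliftP k i) => [j ->|->]; rewrite /= ?lift_perm_lift ?lift_perm_id ?ffunE.
Qed.

Lemma cobound_deg0 (c : cochain R Q 0) : cobound c = 0.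
Proof.
apply/funext => g; rewrite /cobound big_ord0 addr0 expr1 mulrNz mulr1z.
by apply/eqP; rewrite subr_eq0; apply/eqP; congr (c _); apply/ffunP => -[].
Qed.

Lemma slant_coboundary n t (c : cochain R Q n.+1) :
  c \in coboundaries R Q n.+1 -> slant t c \in coboundaries R Q n.
Proof.
(* Coboundaries of degree 1 vanish because the action is trivial. *)
case: n c => [|n] c /asboolP[b ->]; first by rewrite cobound_deg0 raddf0 rpred0.
by rewrite slant_cobound rpredN; apply/asboolP; exists (slant t b).
Qed.

Lemma AS_deg0 (c : cochain R Q 0) : AS c = c.
Proof.
apply/funext => g; rewrite /AS (bigD1 1%g) //= big1 => [|s /eqP[]].
  by rewrite odd_perm1 addr0; congr (c _); apply/ffunP => -[].
by apply/permP => -[].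
Qed.

(** Slant products preserve coboundaries, so expanding [AS] one argument at a time ends in B^0,
    which is trivial. *)
Lemma AS_coboundary n (c : cochain R Q n) : c \in coboundaries R Q n -> AS c = 0.
Proof.
elim: n c => [|n IH] c; first by move=> /eqP ->; rewrite raddf0.
by move=> cB; apply/funext => g; rewrite AS_slant IH //; apply: slant_coboundary.
Qed.

Lemma AS_perm n (c : cochain R Q n) (s : 'S_n) (g : {ffun 'I_n -> Q}) :
  AS c [ffun i => g (s i)] = AS c g *~ (-1) ^+ s.
Proof.
rewrite /AS mulrz_suml (reindex_inj (mulIg s^-1%g)) /=; apply: eq_bigr => u _.
rewrite -mulrzA odd_permM odd_permV signr_addb; congr (c _ *~ _).
by apply/ffunP => i; rewrite !ffunE permM permKV.
Qed.

(** The permutations [s] and [s * tperm i j] give the same value of [c] with opposite signs. *)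
Lemma AS_alternating n (c : cochain R Q n) : alternating (AS c).
Proof.
move=> g i j ij gij; pose t := tperm i j.
have oddMt (s : 'S_n) : (s * t)%g = ~~ s :> bool.
  by rewrite odd_permM odd_tperm ij addbT.
rewrite /AS (bigID (@odd_perm _)) /=.
apply: canLR (subrK _) _; rewrite add0r -sumrN.
rewrite (reindex_inj (mulIg t)); apply: eq_big => //= s.
rewrite oddMt => /negPf ->; rewrite mulrNz mulr1z; congr (- c _).
apply/ffunP => k; rewrite !ffunE permM /t.
by case: tpermP => // ->; rewrite gij.
Qed.

(** In the first argument this is the additivity of slant products up to coboundaries, which [AS]
    kills; a transposition brings any other argument to the first place. *)
Lemma AS_multiadditive n (c : cochain R Q n) :
  c \in cocycles R Q n -> multiadditive (AS c).
Proof.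
case: n c => [|n] c cZ g i x y; first by case: i.
have head (h : {ffun 'I_n.+1 -> Q}) z :
    AS c (upd h ord0 z) = AS (slant z c) [ffun k => h (lift ord0 k)].
  rewrite AS_slant ffunE eqxx; congr (AS _ _).
  by apply/ffunP => k; rewrite !ffunE.
have head_add (h : {ffun 'I_n.+1 -> Q}) :
    AS c (upd h ord0 (x + y)) = AS c (upd h ord0 x) + AS c (upd h ord0 y).
  have /AS_coboundary := slantD x y cZ; rewrite !raddfB /= => /eqP.
  by rewrite -addrA -opprD subr_eq0 !head => /eqP ->.
have swap z : AS c (upd g i z) =
    AS c (upd [ffun k => g (tperm ord0 i k)] ord0 z) *~ (-1) ^+ tperm ord0 i.
  rewrite -AS_perm; congr (AS c _); apply/ffunP => k; rewrite !ffunE tpermK.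
    by rewrite -(inj_eq (@perm_inj _ (tperm ord0 i)) k) tpermR.
by rewrite !swap head_add mulrzDl.
Qed.

Lemma AS_altchar n (c : cochain R Q n) :
  c \in cocycles R Q n -> AS c \in altchars R Q n.
Proof.
by move=> cZ; apply/altcharsP; split; [exact: AS_multiadditive|exact: AS_alternating].
Qed.

End Asymmetrization.

(** * Alternating multi-characters *)

Section AlternatingMaps.
Variables (Q V : zmodType) (n : nat) (c : {ffun 'I_n -> Q} -> V).
Hypotheses (cM : multiadditive c) (cA : alternating c).

Lemma upd_id (g : {ffun 'I_n -> Q}) i : upd g i (g i) = g.
Proof. by apply/ffunP => j; rewrite ffunE; case: eqP => // ->. Qed.

(** Expands the vanishing value with [g i + g j] in both places; only the two mixed terms
    survive. *)
Lemma alternating_swap i j (g : {ffun 'I_n -> Q}) :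
  i != j -> c [ffun k => g (tperm i j k)] = - c g.
Proof.
move=> ij; pose h x y := c (upd (upd g i x) j y).
have hD1 x x' y : h (x + x') y = h x y + h x' y.
  have updC z : upd (upd g i z) j y = upd (upd g j y) i z.
    apply/ffunP => k; rewrite !ffunE.
    by case: (eqVneq k i) => // ->; rewrite (negPf ij).
  by rewrite /h !updC cM.
have hD2 x y y' : h x (y + y') = h x y + h x y' by rewrite /h cM.
have hxx x : h x x = 0.
  by apply: (cA ij); rewrite !ffunE eqxx (negPf ij) eqxx.
have : h (g i + g j) (g i + g j) = 0 by [].
rewrite hD1 !hD2 !hxx addr0 add0r => /eqP; rewrite addrC addr_eq0 => /eqP E.
have -> : c g = h (g i) (g j).
  congr (c _); apply/ffunP => k; rewrite !ffunE.
  by case: eqP => [->//|_]; case: eqP => // ->.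
rewrite -E; congr (c _); apply/ffunP => k; rewrite !ffunE.
case: tpermP => [->|->|/eqP/negPf-> /eqP/negPf->] //; last by rewrite eqxx.
by rewrite (negPf ij) eqxx.
Qed.

Lemma alternating_perm (s : 'S_n) (g : {ffun 'I_n -> Q}) :
  c [ffun k => g (s k)] = c g *~ (-1) ^+ s.
Proof.
have [ts -> dts] := prod_tpermP s; elim: ts dts g => [|[i j] ts IH] /= dts g.
  rewrite big_nil odd_perm1; congr (c _).
  by apply/ffunP => k; rewrite ffunE perm1.
have /andP[/= ij {}dts] := dts.
rewrite big_cons odd_permM odd_tperm ij signr_addb mulN1r mulrNz -(IH dts).
rewrite -(alternating_swap _ ij); congr (c _); apply/ffunP => k.
by rewrite !ffunE permM.
Qed.

End AlternatingMaps.

Section AlternatingCharacters.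
Variables (R : realType) (Q : zmodType) (n : nat).

Lemma AS_altcharE (c : cochain R Q n) : c \in altchars R Q n -> AS c = c *+ n`!.
Proof.
move=> /altcharsP[cM cA]; apply/funext => g; rewrite /AS.
under eq_bigr do rewrite (alternating_perm cM cA) -mulrzA -signr_addb addbb.
by rewrite sumr_const card_Sn; elim: (n`!) => // k IH; rewrite !mulrS IH.
Qed.

(** Multiadditivity splits the face with a sum in place k into the values omitting argument k or k +
    1, so the alternating sum telescopes. *)
Lemma altchars_sub_cocycles : {subset altchars R Q n <= cocycles R Q n}.
Proof.
move=> c /altcharsP[cM _]; apply/(@eqP _ (cobound c))/funext => g.
(* [D k] is the value with argument k omitted; [inord] lets [g] be read at natural indices. *)
pose G k : Q := g (inord k); pose D (k : nat) := c [ffun i : 'I_n => G (bump k i)].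
have g0 (i : 'I_n) : g (lift ord0 i) = G i.+1.
  by congr (g _); apply: val_inj; rewrite /= inordK // ltnS.
have gmax (i : 'I_n) : g (lift ord_max i) = G i.
  congr (g _); apply: val_inj; rewrite /= /bump leqNgt ltn_ord /=.
  by rewrite inordK // ltnS (ltnW (ltn_ord i)).
have face (k : 'I_n) : c (add_adjacent k g) = D k.+1 + D k.
  pose h : {ffun 'I_n -> Q} := [ffun i : 'I_n => G (bump k i)].
  have -> : add_adjacent k g = upd h k (G k + G k.+1).
    apply/ffunP => i; rewrite !ffunE g0 gmax -val_eqE /= /bump.
    by case: ltngtP => [||->]; rewrite ?add0n ?add1n.
  rewrite cM; congr (c _ + c _); apply/ffunP => i; rewrite !ffunE -val_eqE /= /bump.
    by case: ltngtP => [||->]; rewrite ?add0n ?add1n ?eqxx.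
  by case: eqVneq => // ->; rewrite leqnn.
rewrite /cobound (eq_bigr _ (fun (k : 'I_n) _ =>
  congr1 (fun x => x *~ (-1) ^+ k.+1) (face k))).
have -> : c [ffun i => g (lift ord0 i)] = D 0%N.
  by congr (c _); apply/ffunP => i; rewrite !ffunE g0.
have -> : c [ffun i => g (lift ord_max i)] = D n.
  congr (c _); apply/ffunP => i; rewrite !ffunE gmax /bump.
  by rewrite leqNgt ltn_ord.
have step (k : 'I_n) : (D k.+1 + D k) *~ (-1) ^+ k.+1 =
    D k.+1 *~ (-1) ^+ k.+1 - D k *~ (-1) ^+ k.
  by rewrite mulrzDl [in X in _ + X]exprS mulN1r mulrNz.
rewrite (eq_bigr _ (fun k _ => step k)).
rewrite -(big_mkord xpredT (fun k => D k.+1 *~ (-1) ^+ k.+1 - D k *~ (-1) ^+ k)).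
rewrite (telescope_sumr (fun k => D k *~ (-1) ^+ k)) // expr0 mulr1z.
by rewrite exprS mulN1r mulrNz [D 0%N + _]addrC subrK subrr.
Qed.

End AlternatingCharacters.

(** * Splitting off a free generator *)

Section IntAntidifference.
Variable V : zmodType.

(** The solution F of F(j - 1) - F(j) = f(j) with F(0) = 0. *)
Definition antidiff (f : int -> V) (j : int) : V :=
  match j with
  | Posz k => - \sum_(i < k) f i.+1
  | Negz k => \sum_(i < k.+1) f (- i%:Z)
  end.

Lemma antidiffE f j : antidiff f (j - 1) - antidiff f j = f j.
Proof.
case: j => [[|k]|k].
- by rewrite /= big_ord0 big_ord_recl big_ord0 /= !oppr0 !addr0.
- have -> : k.+1%:Z - 1 = k by rewrite -addn1 PoszD addrK.
  by rewrite /= big_ord_recr /=; zmod_eq.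
- have -> : Negz k - 1 = Negz k.+1 by rewrite !NegzE -opprD -PoszD addn1.
  by rewrite /= [X in X - _]big_ord_recr /= NegzE addrAC subrr add0r.
Qed.

End IntAntidifference.

Section SplitLine.
Variables (R : realType) (G : zmodType).
Local Notation V := (circle R).
(** [G] is the direct sum of the image of [p] and of Z t, and [k] is the coordinate along [t]. *)
Variables (p : {additive G -> G}) (k : G -> int) (t : G).
Hypotheses (kB : {morph k : x y / x - y}) (kt : k t = 1) (pt : p t = 0).
Hypothesis split : forall x, x = p x + t *~ k x.

Let p_idem x : p (p x) = p x.
Proof. by rewrite {2}(split x) raddfD raddfMz /= pt mul0rz addr0. Qed.

Let kN x : k (- x) = - k x.
Proof.
have k0 : k 0 = 0 by rewrite -(subrr 0) kB subrr.
by rewrite -[- x]sub0r kB k0 sub0r.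
Qed.

Let kD x y : k (x + y) = k x + k y.
Proof. by rewrite -[y in LHS]opprK kB kN opprK. Qed.

Let kp x : k (p x) = 0.
Proof.
have kz j : k (t *~ j) = j.
  elim/int_rec: j => [|j IH|j IH].
  - by rewrite mulr0z -(subrr 0) kB subrr.
  - by rewrite -addn1 PoszD mulrzDr kD IH mulr1z kt.
  - by rewrite -addn1 PoszD opprD mulrzDr kD IH mulrNz mulr1z kN kt.
have /eqP := congr1 k (split x).
by rewrite kD kz -[X in X == _]add0r (inj_eq (addIr _)) eq_sym => /eqP.
Qed.

Let shiftC u v : +%R u \o +%R v = +%R v \o +%R u :> (G -> G).
Proof. by apply/funext => x /=; rewrite addrCA. Qed.

Let map_shiftC u v (s : seq G) :
  map (+%R u) (map (+%R v) s) = map (+%R v) (map (+%R u) s).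
Proof. by rewrite -!map_comp shiftC. Qed.

Let pinv (C : seq G -> V) := forall a s, C (map (+%R (p a)) s) = C s.

Let prism_pinv C : pinv C -> pinv (prism id p C).
Proof.
move=> Cinv a s; rewrite prism_map.
have -> : p \o +%R (p a) = +%R (p a) \o p.
  by apply/funext => x /=; rewrite raddfD /= p_idem.
rewrite -[id \o +%R (p a)]/(+%R (p a) \o id) prism_comp.
by congr (prism _ _ _ s); apply/funext => u; rewrite Cinv.
Qed.

(* The prism [B] between the identity and [p] is a primitive of [c] invariant under
   the image of [p] only.  Its variation [B'] along [- t] is a cocycle which the
   hypothesis on the slant product makes the coboundary of some [E]; subtracting
   from [B] the coboundary of an antiderivative [E'] of [E] along [- t] makes it
   invariant. *)
Lemma coboundary_of_slant0 n (c : cochain R G n.+1) :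
  c \in cocycles R G n.+1 -> pullback p c = 0 ->
  pullback p (slant t c) \in coboundaries R G n -> c \in coboundaries R G n.+1.
Proof.
move=> /cocyclesP cZ cp0 /coboundariesP[F [Finv F0 cF]].
pose C := homog c; have Cinv : invariant C := homog_inv c.
have homog_p m (d : cochain R G m) s : homog d (map p s) = homog (pullback p d) s.
  rewrite /homog size_map; case: eqP => // sm; congr (d _).
  apply/ffunP => i; rewrite !ffunE raddfB /=.
  by rewrite !(nth_map 0) // sm ?ltnS // ltnW.
have Cp s : C (map p s) = 0 by rewrite /C homog_p cp0 homog0.
pose B s := - prism id p C s.
have delBE s : del B s = C s.
  have := del_prism id p C s; rewrite map_id Cp sub0r.
  have -> : del C = fun=> 0 by apply/funext.
  by rewrite prism0 addr0 delN => ->; rewrite opprK.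
have Binv : pinv B.
  by move=> a s; congr (- _); apply: prism_pinv => b u; rewrite Cinv.
pose B' s := B (map (+%R (- t)) s) - B s.
have delB' s : del B' s = 0.
  rewrite (delB (fun u => B (map (+%R (- t)) u))) -(del_map _ B).
  by rewrite !delBE Cinv subrr.
have B'inv : pinv B' by move=> a s; rewrite /B' map_shiftC !Binv.
(* Translated by [t], the prism from [id] to [p] at [p s - t] becomes the one defining the slant
   product, which is [del F] on the image of [p]; the prism at [p s] vanishes as [C] does on that
   image. *)
have B'p s : B' (map p s) = - del F s.
  rewrite /B' /B -cF opprK -homog_p homog_slant -/C.
  have -> : prism id p C (map p s) = 0.
    rewrite prism_map -[id \o p]/(p \o id).
    have -> : p \o p = p \o id by apply/funext => x /=; rewrite p_idem.
    rewrite prism_comp (_ : (fun u => C (map p u)) = fun=> 0) ?prism0 //.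
    exact/funext.
  rewrite addr0; congr (- _).
  have id0 : id = +%R 0 :> (G -> G) by apply/funext => x; rewrite add0r.
  rewrite [in RHS]id0 -(prism_inv _ _ Cinv (- t)) !prism_map; congr (prism _ _ _ s).
    by apply/funext => x /=; rewrite add0r.
  by apply/funext => x /=; rewrite raddfD raddfN /= pt oppr0 add0r p_idem addNKr.
(* The homotopy formula for the cocycle [B'] turns the primitive [- F] of its restriction to the
   image of [p] into a primitive of [B']. *)
pose E s := - F s - prism id p B' s.
have E0 : E [::] = 0 by rewrite /E F0 /= oppr0 addr0.
have delE s : del E s = B' s.
  rewrite (delB (fun u => - F u)) delN.
  have := del_prism id p B' s; rewrite map_id B'p.
  have -> : del B' = fun=> 0 by apply/funext.
  by rewrite prism0 addr0 => ->; rewrite opprB addrC subrK.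
have Einv : pinv E by move=> a s; rewrite /E Finv prism_pinv.
(* The function of j is [E] at the translate of [s] along [t] whose first entry has coordinate j. *)
pose E' s := if s is x :: _ then
  antidiff (fun j => E (map (+%R (t *~ (j - k x))) s)) (k x) else 0.
have E'E x s : E' (x :: s) =
    antidiff (fun j => E (map (+%R (t *~ (j - k x))) (x :: s))) (k x) by [].
have E'B s : E' (map (+%R (- t)) s) - E' s = E s.
  case: s => [|x s]; first by rewrite /= subrr E0.
  rewrite map_cons !E'E -(map_cons (+%R (- t)) x s) kD kN kt [-1 + k x]addrC.
  have -> : (fun j => E (map (+%R (t *~ (j - (k x - 1)))) (map (+%R (- t)) (x :: s))))
     = (fun j => E (map (+%R (t *~ (j - k x))) (x :: s))).
    apply/funext => j; rewrite -map_comp; congr E; apply: eq_map => y /=.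
    have -> : j - (k x - 1) = (j - k x) + 1 by rewrite opprB addrCA addrC.
    by rewrite mulrzDr mulr1z -addrA addNKr.
  rewrite antidiffE subrr mulr0z.
  by rewrite (eq_map (g := id)) ?map_id // => y; rewrite /= add0r.
have E'inv : pinv E'.
  move=> a [|x s] //; rewrite map_cons !E'E -(map_cons (+%R (p a)) x s) kD kp add0r.
  by congr antidiff; apply/funext => j; rewrite map_shiftC Einv.
pose B'' s := B s - del E' s.
have B''p : pinv B''.
  move=> a s; rewrite /B'' Binv del_map; congr (_ - _).
  by apply: eq_del => u; exact: E'inv.
have B''t s : B'' (map (+%R (- t)) s) = B'' s.
  apply/eqP; rewrite -subr_eq0 /B''; apply/eqP.
  have : del E s = del (fun u => E' (map (+%R (- t)) u)) s - del E' s.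
    by rewrite -delB; apply: eq_del => u; rewrite E'B.
  rewrite delE /B' -del_map => BE.
  move: BE; move: (B _) (B s) (del E' _) (del E' s) => a b d e BE.
  have -> : a - d - (b - e) = a - b - (d - e) by zmod_eq.
  by rewrite BE subrr.
have B''z j s : B'' (map (+%R (t *~ j)) s) = B'' s.
  elim/int_rec: j s => [|j IH|j IH] s.
  - by rewrite mulr0z (eq_map (g := id)) ?map_id // => y; rewrite /= add0r.
  - rewrite -[LHS]B''t -map_comp -[RHS]IH; congr B''; apply: eq_map => y /=.
    by rewrite -!pmulrn mulrS -addrA addKr.
  - rewrite -[RHS]IH -[RHS]B''t -map_comp; congr B''; apply: eq_map => y /=.
    by rewrite !mulrNz -!pmulrn mulrS opprD -addrA.
apply/coboundariesP; exists B''; split=> [u s||s].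
(* Translations by the image of [p] and by multiples of [t] generate all translations. *)
- rewrite {1}(split u) -[RHS](B''z (k u)) -[RHS](B''p u) -map_comp; congr B''.
  by apply: eq_map => y /=; rewrite addrA.
- by rewrite /B'' /B /= oppr0 addr0.
- by rewrite /B'' (delB B) del_del delBE subr0.
Qed.

End SplitLine.

(** * Exactness for Z^m *)

Section ASExact.
Variable R : realType.

(** All degrees at once: splitting off a generator uses the complement in degree n + 1 for [c] and
    in degree n for its slant product. *)
Definition AS_exact (Q : zmodType) := forall n (c : cochain R Q n),
  c \in cocycles R Q n -> AS c = 0 -> c \in coboundaries R Q n.

Lemma AS_pullback (Q Q' : zmodType) (phi : {additive Q -> Q'}) n
    (c : cochain R Q' n) : AS (pullback phi c) = pullback phi (AS c).
Proof.
apply/funext => g; apply: eq_bigr => s _; congr (c _ *~ _).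
by apply/ffunP => i; rewrite !ffunE.
Qed.

Lemma pullback_cocycles (Q Q' : zmodType) (phi : {additive Q -> Q'}) n
    (c : cochain R Q' n) :
  c \in cocycles R Q' n -> pullback phi c \in cocycles R Q n.
Proof.
by move=> /(@eqP _ (cobound c)) c0; apply/eqP; rewrite -pullback_cobound c0 raddf0.
Qed.

Lemma pullback_comp (Q Q' Q'' : zmodType) (phi : {additive Q -> Q'})
    (psi : {additive Q' -> Q''}) n (c : cochain R Q'' n) :
  pullback (psi \o phi) c = pullback phi (pullback psi c).
Proof.
by apply/funext => g; congr (c _); apply/ffunP => i; rewrite !ffunE.
Qed.

(** The cone with apex 0 is a primitive, invariant because all translations are trivial. *)
Lemma AS_exact_trivial (Q : zmodType) : (forall x : Q, x = 0) -> AS_exact Q.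
Proof.
move=> Q0 [|n] c cZ c0; first by rewrite -(AS_deg0 c) c0 rpred0.
apply/coboundariesP; exists (fun s => homog c (0 :: s)); split=> [u s||s] //.
  rewrite (eq_map (g := id)) ?map_id // => x.
  by rewrite [LHS]Q0 [RHS]Q0.
have /cocyclesP/(_ (0 :: s)) /= /eqP := cZ.
by rewrite subr_eq0 => /eqP.
Qed.

(** The pullback of [c] along the projection to [A] is a coboundary, and subtracting it leaves a
    cocycle vanishing on [A]. Slant products by [t] are handled on [A] too, as [AS (slant t c)] is
    [AS c] with first argument [t]. *)
Lemma AS_exact_split (A G : zmodType) (iota : {additive A -> G})
    (pi : {additive G -> A}) (k : G -> int) (t : G) :
  {morph k : x y / x - y} -> k t = 1 -> pi t = 0 ->
  (forall a, pi (iota a) = a) -> (forall x, x = iota (pi x) + t *~ k x) ->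
  AS_exact A -> AS_exact G.
Proof.
move=> kB kt pit piK Gsplit exA [|n] c cZ c0; first by rewrite -(AS_deg0 c) c0 rpred0.
pose p : {additive G -> G} := iota \o pi.
have exp m (d : cochain R G m) : d \in cocycles R G m -> AS d = 0 ->
    pullback p d \in coboundaries R G m.
  move=> dZ d0; rewrite pullback_comp; apply/pullback_coboundary/exA.
    exact: pullback_cocycles.
  by rewrite AS_pullback d0 raddf0.
have cpB := exp _ c cZ c0.
rewrite -[c](subrK (pullback p c)) rpredD //.
have pt : p t = 0 by rewrite /p /= pit raddf0.
apply: (coboundary_of_slant0 kB kt pt) => //.
- by rewrite rpredB //; exact: pullback_cocycles.
- rewrite raddfB /= -pullback_comp; apply/eqP; rewrite subr_eq0; apply/eqP.
  apply/funext => g; congr (c _); apply/ffunP => i.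
  by rewrite !ffunE /= piK.
- rewrite !raddfB /= rpredB //; last first.
    by apply: pullback_coboundary; exact: slant_coboundary.
  apply: exp; first exact: slant_cocycle.
  apply/funext => g; pose h : {ffun 'I_n.+1 -> G} := [ffun i => oapp g t (unlift ord0 i)].
  have := congr1 (fun d : cochain R G n.+1 => d h) c0.
  rewrite AS_slant ffunE unlift_none /=; congr (AS _ _ = _).
  by apply/ffunP => i; rewrite !ffunE liftK.
Qed.

Lemma AS_exact_int m : AS_exact 'rV[int]_m.
Proof.
elim: m => [|m IH]; first by apply: AS_exact_trivial => x; exact: thinmx0.
apply: (@AS_exact_split _ 'rV[int]_(1 + m) (mulmxr (row_mx 0 1%:M)) rsubmx
  (fun x => lsubmx x 0 0) (row_mx 1%:M 0)) IH => [x y|||v|x].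
- by rewrite raddfB /= !mxE.
- by rewrite row_mxKl mxE eqxx.
- by rewrite /= row_mxKr.
- by rewrite /= mul_mx_row mulmx0 mulmx1 row_mxKr.
- rewrite /= mul_mx_row mulmx0 mulmx1 -scaler_int intz scale_row_mx scaler0 add_row_mx.
  by rewrite add0r addr0 scalemx1 -mx11_scalar hsubmxK.
Qed.

End ASExact.

(** * Finitely generated subgroups of torsion free groups *)

Section FreeSubgroups.
Variable Q : zmodType.

Definition lincomb m (e : 'I_m -> Q) (v : 'rV[int]_m) : Q :=
  \sum_i e i *~ v 0 i.

Lemma lincomb_is_zmod_morphism m e : {morph @lincomb m e : v w / v - w}.
Proof.
move=> v w; rewrite /lincomb -sumrB; apply: eq_bigr => i _.
by rewrite !mxE mulrzBr.
Qed.

HB.instance Definition _ m e := GRing.isZmodMorphism.Build 'rV[int]_m Q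
  (@lincomb m e) (@lincomb_is_zmod_morphism m e).

Lemma lincomb_delta m e i : @lincomb m e (delta_mx 0 i) = e i.
Proof.
rewrite /lincomb (bigD1 i) //= big1 => [|j ji]; rewrite mxE eqxx.
  by rewrite eqxx addr0.
by rewrite (negPf ji).
Qed.

Hypothesis tfQ : torsion_free Q.

Lemma torsion_free_int (x : Q) (z : int) : z != 0 -> x *~ z = 0 -> x = 0.
Proof.
case: z => k z0; first by apply: tfQ; rewrite lt0n.
by rewrite NegzE mulrNz => /eqP; rewrite oppr_eq0 => /eqP; exact: tfQ.
Qed.

(* By the Smith normal form a relation is a multiple of a vector of some basis,
   which [f] kills as [Q] is torsion free and which can thus be dropped. *)
Lemma free_cover m (f : {additive 'rV[int]_m -> Q}) :
  exists m' (f' : {additive 'rV[int]_m' -> Q}),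
    injective f' /\ forall v, exists w, f' w = f v.
Proof.
elim: m f => [|m IH] f.
  by exists 0%N, f; split=> [v w _|v]; [rewrite [v]thinmx0 [w]thinmx0|exists v].
have [finj|] := pselect (injective f); first by exists m.+1, f; split=> // v; exists v.
move=> /existsNP[v /existsNP[w /not_implyP[fvw vw]]].
pose a : 'rV[int]_(1 + m) := v - w.
have fa : f a = 0 by rewrite raddfB fvw subrr.
have a0 : a != 0 by rewrite subr_eq0; apply/eqP.
(* As [a] has a single row, it is a multiple of [e *m U], the first row of the invertible matrix
   [U]. *)
have [L _ [U Uu [d _ aE]]] := int_Smith_normal_form a.
pose e : 'rV[int]_(1 + m) := row_mx 1%:M 0.
have aE' : a = (L 0 0 * d`_0) *: (e *m U).
  rewrite aE scalemxAl {1}[L]mx11_scalar mul_scalar_mx -scalerA; congr (_ *: _ *m U).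
  apply/rowP => j; rewrite !mxE /=.
  by case: splitP => j' -> /=; rewrite !mxE ?mulr0 // ord1 !eqxx mulr1.
have z0 : L 0 0 * d`_0 != 0 by apply: contraNneq a0 => z; rewrite aE' z scale0r.
have feU : f (e *m U) = 0.
  by apply: (torsion_free_int z0); rewrite -raddfMz -fa aE' -scaler_int intz.
(* The restriction of [f] to the span of the other rows of [U]. *)
pose g : {additive 'rV[int]_m -> Q} := f \o mulmxr (row_mx 0 1%:M *m U).
have [m' [f' [f'inj f'g]]] := IH g; exists m', f'; split=> // u.
have [x f'x] := f'g (rsubmx (u *m invmx U : 'rV[int]_(1 + m))).
exists x; rewrite f'x /g /= mulmxA mul_mx_row mulmx0 mulmx1.
rewrite -[in RHS](mulmxKV Uu u); set b := u *m _.
have -> : b *m U = lsubmx b 0 0 *: (e *m U) + row_mx 0 (rsubmx b) *m U.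
  rewrite scalemxAl -mulmxDl scale_row_mx scaler0 scalemx1 -mx11_scalar.
  by rewrite add_row_mx addr0 add0r hsubmxK.
by rewrite raddfD /= -[_ 0 0]intz scaler_int raddfMz feU mul0rz add0r.
Qed.

Lemma free_subgroup (s : seq Q) : exists m (f : {additive 'rV[int]_m -> Q}),
  injective f /\ forall x, x \in s -> exists v, f v = x.
Proof.
have [m [f [finj fs]]] := free_cover (@lincomb (size s) (fun i => s`_i)).
exists m, f; split=> // x xs; have xi := xs; rewrite -index_mem in xi.
have [v fv] := fs (delta_mx 0 (Ordinal xi)); exists v.
by rewrite fv [LHS]lincomb_delta nth_index.
Qed.

End FreeSubgroups.

(** * Topology of the circle *)

Section CircleTopology.
Variable R : realType.
Local Notation T := (circle R).

Lemma circle_continuousB (S : topologicalType) (f g : S -> T) :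
  continuous f -> continuous g -> continuous (fun x => f x - g x).
Proof.
move=> fc gc x.
apply: (@continuous_comp _ _ _ (fun y => (f y, g y)) (fun z : T * T => z.1 - z.2)).
  exact: (cvg_pair (fc x) (gc x)).
exact: circle_sub_continuous.
Qed.

Lemma circle_continuous_cst (S : topologicalType) (a : T) :
  continuous (fun _ : S => a).
Proof. by move=> x; apply: cvg_cst. Qed.

Lemma circle_continuousN (S : topologicalType) (f : S -> T) :
  continuous f -> continuous (fun x => - f x).
Proof.
move=> fc; rewrite (_ : (fun x => - f x) = fun x => 0 - f x).
  by apply: circle_continuousB => //; exact: circle_continuous_cst.
by apply/funext => x; rewrite sub0r.
Qed.

Lemma circle_continuousD (S : topologicalType) (f g : S -> T) :
  continuous f -> continuous g -> continuous (fun x => f x + g x).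
Proof.
move=> fc gc; rewrite (_ : (fun x => f x + g x) = fun x => f x - (- g x)).
  by apply: circle_continuousB => //; exact: circle_continuousN.
by apply/funext => x; rewrite opprK.
Qed.

Lemma circle_continuousMn (S : topologicalType) (f : S -> T) n :
  continuous f -> continuous (fun x => f x *+ n).
Proof.
move=> fc; elim: n => [|n IH]; first exact: circle_continuous_cst.
rewrite (_ : (fun x => f x *+ n.+1) = fun x => f x + f x *+ n).
  exact: circle_continuousD.
by apply/funext => x; rewrite mulrS.
Qed.

Lemma circle_continuousMz (S : topologicalType) (f : S -> T) (z : int) :
  continuous f -> continuous (fun x => f x *~ z).
Proof.
move=> fc; case: z => n; first exact: circle_continuousMn.
by apply: circle_continuousN; exact: circle_continuousMn.
Qed.

Lemma circle_continuous_sum (S : topologicalType) (I : Type) (r : seq I)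
    (P : pred I) (f : I -> S -> T) :
  (forall i, continuous (f i)) -> continuous (fun x => \sum_(i <- r | P i) f i x).
Proof.
move=> fc; elim: r => [|i r IH].
  rewrite (_ : (fun x => _) = fun=> 0); first exact: circle_continuous_cst.
  by apply/funext => x; rewrite big_nil.
rewrite (_ : (fun x => _) = fun x =>
    (if P i then f i x else 0) + \sum_(i <- r | P i) f i x).
  apply: circle_continuousD => //.
  by case: (P i) => //; exact: circle_continuous_cst.
by apply/funext => x; rewrite big_cons; case: (P i); rewrite ?add0r.
Qed.

Lemma circle_hausdorff : hausdorff_space T.
Proof.
move=> a b ab; apply: val_inj.
apply: (@norm_hausdorff _ R[i]^o) => A B nA nB.
have [z [Az Bz]] := ab _ _ (circle_val_continuous nA) (circle_val_continuous nB).
by exists (circle_val z).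
Qed.

Lemma circle_closed_eq (S : topologicalType) (f : S -> T) (a : T) :
  continuous f -> closed [set x | f x = a].
Proof.
move=> fc; apply: (@closed_comp _ _ f [set a]) => [x _|]; first exact: fc.
by apply: accessible_closed_set1; apply: hausdorff_accessible; exact: circle_hausdorff.
Qed.

Lemma circle_divisible (a : T) N : (0 < N)%N -> exists b, b *+ N = a.
Proof.
move=> N0; have nb : `|N.-root (circle_val a) : R[i]| == 1.
  by rewrite norm_rootC (eqP (circle_norm a)) rootC1.
exists (Circle nb); apply: val_inj.
have valMn (z : T) n : circle_val (z *+ n) = circle_val z ^+ n.
  by elim: n => // n IH; rewrite mulrS exprS -IH.
by rewrite [LHS]valMn /= rootCK.
Qed.

End CircleTopology.

(** * Compactness of the circle *)

Section CircleCompact.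
Variable R : realType.
Local Notation T := (circle R).
Local Open Scope complex_scope.

Lemma real_complex_continuous : continuous (real_complex R : R -> R[i]^o).
Proof.
move=> x; apply/cvgrPdist_lt => e e0.
(* The radius [e] lies in [R[i]]; being positive, it is real. *)
have eE : e = (complex.Re e)%:C.
  by move: e0; rewrite ltcE; case: (e) => a b /andP[/eqP/= -> _].
have e0' : 0 < complex.Re e by move: e0; rewrite eE ltcR.
near=> y.
rewrite -rmorphB /= eE [X in X < _]normc_def /= expr0n addr0 sqrtr_sqr ltcR.
near: y; apply: (@cvgr_dist_lt _ R^o) => //.
Unshelve. all: by end_near. Qed.

(* [cayley] maps [-1, 1] onto the right half of the circle; the left half is its
   image under multiplication by -1. *)
Definition cayley_den (s : R) : R[i] := 1 - 'i%C * s%:C.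

Lemma cayley_den_neq0 s : cayley_den s != 0.
Proof.
rewrite /cayley_den eq_complex /= negb_and; apply/orP; left.
by rewrite mul0r mul1r !oppr0 ?addr0 subr0 oner_eq0.
Qed.

(** Numerator and denominator are conjugate. *)
Lemma cayley_norm s : `|(1 + 'i%C * s%:C) / cayley_den s| == 1 :> R[i].
Proof.
have E : `|1 + 'i%C * s%:C| = `|cayley_den s|.
  by rewrite !normc_def /=; congr (Num.sqrt _)%:C; ring.
by rewrite normrM normfV E divff ?normr_eq0 ?cayley_den_neq0.
Qed.

Definition cayley s : T := Circle (cayley_norm s).

Lemma cayley_continuous : continuous cayley.
Proof.
apply: (@continuous_comp_initial _ _ _ (@circle_val R : T -> R[i]^o)) => s.
have ic : {for s, continuous (fun s : R => 'i%C * s%:C : R[i]^o)}.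
  by apply: (@cvgM R[i]^o); [exact: cvg_cst|exact: real_complex_continuous].
have cc (a : R[i]^o) : {for s, continuous (fun=> a : R[i]^o)} by exact: cvg_cst.
have dc : {for s, continuous (cayley_den : R -> R[i]^o)} 
  := @cvgB _ R[i]^o _ _ (nbhs_filter s) _ _ _ _ (cc 1) ic.
have nc : {for s, continuous (fun s : R => 1 + 'i%C * s%:C : R[i]^o)} 
  := @cvgD _ R[i]^o _ _ (nbhs_filter s) _ _ _ _ (cc 1) ic.
have vc := @cvgV R[i]^o _ _ (nbhs_filter s) _ _ (cayley_den_neq0 s) dc.
exact: (@cvgM R[i]^o _ _ (nbhs_filter s) _ _ _ _ nc vc).
Qed.

Lemma cayley_surj (z : T) : 0 <= complex.Re (circle_val z) ->
  exists2 s, `[-1, 1]%classic s & cayley s = z.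
Proof.
case: z => -[x y] /= n1 x0.
have /eqP xy : x ^+ 2 + y ^+ 2 == 1.
  move: n1; rewrite normc_def /= => /eqP/(congr1 (@complex.Re R)) /= n1.
  by rewrite -[_ + _]sqr_sqrtr ?addr_ge0 ?sqr_ge0 // n1 expr1n.
have x1 : 1 + x != 0 by rewrite gt_eqF // ltr_pwDl.
(* The tangent of half the argument of x + iy, of absolute value at most 1 since x >= 0. *)
exists (y / (1 + x)).
  rewrite /= in_itv /= -ler_norml normrM normfV ler_pdivrMr ?normr_gt0 // mul1r.
  rewrite (ger0_norm (addr_ge0 ler01 x0)) -ler_sqr ?nnegrE ?addr_ge0 //.
  rewrite real_normK ?num_real //; nra.
apply: val_inj; rewrite /= /cayley_den.
apply: (canLR (mulfK (cayley_den_neq0 _))).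
have sx : y / (1 + x) * (1 + x) = y by rewrite divfK.
have ys : y * (y / (1 + x)) = 1 - x.
  rewrite mulrA -expr2; apply: (canLR (mulfK x1)).
  by rewrite -[LHS](addKr (x ^+ 2)) xy; ring.
move: sx ys; move: (y / (1 + x)) => s sx ys.
apply/eqP; rewrite eq_complex /=; apply/andP; split; apply/eqP; lra.
Qed.

Lemma circle_compact : compact [set: T].
Proof.
pose I := `[-1 : R, 1]%classic.
have cI : compact (cayley @` I).
  apply: continuous_compact; last exact: segment_compact.
  by apply: continuous_subspaceT; exact: cayley_continuous.
have n1 : `|- 1 : R[i]| == 1 by rewrite normrN normr1.
pose m : T := Circle n1.
have mm : m + m = 0 by apply: val_inj; rewrite /= mulrNN mulr1.
have cmI : compact ((fun s => cayley s + m) @` I).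
  apply: continuous_compact; last exact: segment_compact.
  apply: continuous_subspaceT; apply: circle_continuousD; first exact: cayley_continuous.
  exact: circle_continuous_cst.
rewrite (_ : setT = cayley @` I `|` (fun s => cayley s + m) @` I).
  exact: compactU.
apply/seteqP; split=> // z _.
have [z0|z0] := leP 0 (complex.Re (circle_val z)).
  by have [s Is <-] := cayley_surj z0; left; exists s.
have [|s Is sz] := @cayley_surj (z + m).
  have -> : circle_val (z + m) = - circle_val z by rewrite /= mulrN1.
  by rewrite raddfN oppr_ge0 ltW.
by right; exists s => //; rewrite sz -addrA mm addr0.
Qed.

End CircleCompact.

(** * Compactness arguments *)

Section Compactness.
Variable R : realType.
Local Notation T := (circle R).

Lemma eval_continuous (X : choiceType) (x : X) :
  continuous (fun b : {ptws X -> T} => b x).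
Proof. exact: (@proj_continuous X (fun=> T) x). Qed.

(** All functions form a compact space by Tychonoff, and the solution sets of finite subsystems
    generate a proper filter; a cluster point of it lies in every closed [E j]. *)
Lemma finitely_solvable (X J : choiceType) (E : J -> set {ptws X -> T}) :
  (forall j, closed (E j)) ->
  (forall s : seq J, exists b, forall j, j \in s -> E j b) ->
  exists b, forall j, E j b.
Proof.
move=> Ecl Efin.
have cT : compact [set: {ptws X -> T}].
  have := @tychonoff X (fun=> T) (fun=> setT) (fun=> @circle_compact R).
  by congr compact; apply/seteqP; split.
pose F := filter_from [set: seq J] (fun s => [set b | forall j, j \in s -> E j b]).
have FF : ProperFilter F.
  apply: filter_from_proper; last by move=> s _; exact: Efin.
  apply: filter_from_filter; first by exists [::].
  move=> s s' _ _; exists (s ++ s') => // b Eb.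
  by split=> j js; apply: Eb; rewrite mem_cat js ?orbT.
have [b [_ Fb]] := cT F FF filterT.
exists b => j; apply: Ecl => U nU.
have [] := Fb (E j) U _ nU; last by move=> x ?; exists x.
by exists [:: j] => // d; apply; rewrite inE.
Qed.

Definition preimage_or0 (A Q : zmodType) (f : A -> Q) (x : Q) : A :=
  xget 0 [set v | f v = x].

Lemma preimage_or0_im (A Q : zmodType) (f : A -> Q) x :
  (exists v, f v = x) -> f (preimage_or0 f x) = x.
Proof.
by move=> [v fv]; exact: (@xgetPex _ 0 [set w | f w = x] (ex_intro _ v fv)).
Qed.

Lemma preimage_or0K (A Q : zmodType) (f : A -> Q) :
  injective f -> cancel f (preimage_or0 f).
Proof. by move=> finj v; apply: finj; apply: preimage_or0_im; exists v. Qed.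

Lemma AS_exact_torsion_free (Q : zmodType) : torsion_free Q -> AS_exact R Q.
Proof.
move=> tfQ [|n] c cZ c0; first by rewrite -(AS_deg0 c) c0 rpred0.
suff [b bE] : exists b : {ptws {ffun 'I_n -> Q} -> T}, forall g, cobound b g = c g.
  by apply/asboolP; exists b; apply/funext => g; rewrite bE.
apply: (finitely_solvable (E := fun g => [set b | cobound b g = c g])) => [g|s].
  apply: circle_closed_eq; apply: circle_continuousD; last first.
    by apply: circle_continuousMz; exact: eval_continuous.
  apply: circle_continuousD; first exact: eval_continuous.
  apply: circle_continuous_sum => k.
  by apply: circle_continuousMz; exact: eval_continuous.
have [m [f [finj fs]]] :=
  free_subgroup tfQ (flatten [seq codom g | g : {ffun _ -> _} <- s]).
have /asboolP[b0 b0E] : pullback f c \in coboundaries R _ n.+1.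
  apply: AS_exact_int; first exact: pullback_cocycles.
  by rewrite AS_pullback c0 raddf0.
(* Extends the primitive [b0] from the image of [f] to [Q]; the equations at the tuples in [s] see
   only values on that image. *)
pose b : cochain R Q n := fun g => b0 [ffun i => preimage_or0 f (g i)].
have bf : pullback f b = b0.
  apply/funext => g; congr (b0 _); apply/ffunP => i.
  by rewrite !ffunE preimage_or0K.
exists b => g gs; pose h : {ffun 'I_n.+1 -> _} := [ffun i => preimage_or0 f (g i)].
have -> : g = map_args f h.
  apply/ffunP => i; rewrite !ffunE preimage_or0_im //; apply: fs.
  by apply/flattenP; exists (codom g); [exact: map_f|exact: codom_f].
have := congr1 (fun d : cochain R _ n.+1 => d h) (pullback_cobound f b).
by rewrite bf -b0E.
Qed.

End Compactness.

(** * Alternating maps on Z^m *)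

Section MatrixContinuity.
Variables (V : topologicalType) (m n : nat).

Lemma mx_entry_continuous i j : continuous (fun M : 'M[V]_(m, n) => M i j).
Proof.
move=> M U nU; exists (fun i' j' => [set x | i' = i -> j' = j -> U x]).
  move=> i' j'; have [[-> ->]|ij] := pselect (i' = i /\ j' = j).
    by apply: filterS nU => x Ux.
  by apply: filterE => x i'i j'j; case: ij.
by move=> N /(_ i j); exact.
Qed.

Lemma mx_continuous (S : topologicalType) (f : S -> 'M[V]_(m, n)) :
  (forall i j, continuous (fun x => f x i j)) -> continuous f.
Proof.
move=> fc x A [P nP sPA].
have := @filter_forall S _ (fun ij : 'I_m * 'I_n =>
  [set y | P ij.1 ij.2 (f y ij.1 ij.2)]) (nbhs x) (nbhs_filter x).
move=> /(_ (fun ij => fc ij.1 ij.2 x _ (nP _ _))).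
by apply: filterS => y Py; apply: sPA => i j; exact: (Py (i, j)).
Qed.

End MatrixContinuity.

Section AlternatingOnFree.
Variables (V : zmodType) (m n : nat).
Local Notation L := 'rV[int]_m.

Lemma additive_rV_eq0 (A : L -> V) : {morph A : x y / x + y} ->
  (forall j, A (delta_mx 0 j) = 0) -> forall v, A v = 0.
Proof.
move=> AD Adelta v.
have A0 : A 0 = 0 by apply: (addrI (A 0)); rewrite -AD !addr0.
have AN x : A (- x) = - A x by apply: (addrI (A x)); rewrite -AD !subrr A0.
rewrite (row_sum_delta v) (big_morph A AD A0) big1 // => j _.
rewrite -[v 0 j]intz scaler_int; elim/int_rec: (v 0 j) => [|k IH|k IH].
- by rewrite mulr0z.
- by rewrite -pmulrn mulrSr AD pmulrn IH add0r; exact: Adelta.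
- rewrite mulrNz -pmulrn mulrSr opprD AD pmulrn -mulrNz IH add0r AN.
  by rewrite [A _]Adelta oppr0.
Qed.

Definition basis_args (phi : 'I_n -> 'I_m) : {ffun 'I_n -> L} :=
  [ffun a => delta_mx 0 (phi a)].

Lemma multiadditive_eq0 (c : {ffun 'I_n -> L} -> V) : multiadditive c ->
  (forall phi, c (basis_args phi) = 0) -> forall g, c g = 0.
Proof.
move=> cM cb g.
(* Induction on k: the arguments from position k on are unit vectors, and each step frees one more
   argument. *)
suff H k : (k <= n)%N -> forall h : {ffun 'I_n -> L},
    (forall a : 'I_n, (k <= a)%N -> exists j, h a = delta_mx 0 j) -> c h = 0.
  by apply: (H n (leqnn n)) => a; rewrite leqNgt ltn_ord.
elim: k => [_|k IH kn] h hb.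
  have [phi phiE] := fin_all_exists (fun a => hb a (leq0n a)).
  by rewrite -(cb phi); congr c; apply/ffunP => a; rewrite ffunE.
pose i := Ordinal kn; rewrite -(upd_id h i).
apply: (@additive_rV_eq0 (fun x => c (upd h i x))) => [x y|j]; first exact: cM.
apply: IH => [|a ka]; first exact: ltnW.
rewrite ffunE; case: eqVneq => [_|ai]; first by exists j.
by apply: hb; rewrite ltn_neqAle ka andbT eq_sym -val_eqE in ai *.
Qed.

Lemma perm_of_images (phi psi : 'I_n -> 'I_m) : injective phi ->
  (forall a, exists b, phi a = psi b) -> exists s : 'S_n, forall a, phi a = psi (s a).
Proof.
move=> inj_phi /fin_all_exists[f fE].
have finj : injective f by move=> a b fab; apply: inj_phi; rewrite !fE fab.
by exists (perm finj) => a; rewrite permE fE.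
Qed.

(** A basis tuple with a repetition is killed by alternation, and one without is a reordering of
    some [phi j]. The type [J] may be empty. *)
Lemma alternating_eq0 (c : {ffun 'I_n -> L} -> V)
    (J : Type) (phi : J -> 'I_n -> 'I_m) :
  multiadditive c -> alternating c ->
  (forall psi : 'I_n -> 'I_m, injective psi ->
     exists j, forall a, exists b, psi a = phi j b) ->
  (forall j, c (basis_args (phi j)) = 0) -> forall g, c g = 0.
Proof.
move=> cM cA phi_all c0; apply: multiadditive_eq0 => // psi.
have [/injectiveP psi_inj|/injectivePn[a [b [ab psiab]]]] := boolP (injectiveb psi).
  have [j /(perm_of_images psi_inj)[s sE]] := phi_all psi psi_inj.
  have -> : basis_args psi = [ffun a => basis_args (phi j) (s a)].
    by apply/ffunP => a; rewrite !ffunE sE.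
  by rewrite alternating_perm // c0 mul0rz.
by apply: (cA _ a b ab); rewrite !ffunE psiab.
Qed.

End AlternatingOnFree.

Lemma subset_enumerations m n : (n <= m)%N ->
  exists phi : 'I_'C(m, n) -> 'I_n -> 'I_m,
    [/\ forall j, injective (phi j),
        forall psi : 'I_n -> 'I_m, injective psi ->
          exists j, forall a, exists b, psi a = phi j b
      & forall j j', (forall a, exists b, phi j a = phi j' b) -> j = j'].
Proof.
move=> nm; pose A := [set S : {set 'I_m} | #|S| == n]%SET.
have cA : #|A| = 'C(m, n) by rewrite card_draws card_ord.
pose S j : {set 'I_m} := enum_val (cast_ord (esym cA) j).
have cS j : #|S j| = n by have := enum_valP (cast_ord (esym cA) j); rewrite inE => /eqP.
(* The default of [nth] is never reached, as [S j] has n elements. *)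
pose phi j (a : 'I_n) := nth (widen_ord nm a) (enum (S j)) a.
have phiS j a : phi j a \in S j by rewrite -mem_enum mem_nth // -cardE cS.
have Sphi j x : x \in S j -> exists a, x = phi j a.
  rewrite -mem_enum => xS; have ixn : (index x (enum (S j)) < n)%N.
    by rewrite -(cS j) cardE index_mem.
  by exists (Ordinal ixn); rewrite /phi nth_index.
exists phi; split=> [j a b|psi psi_inj|j j' jj'].
- rewrite /phi (set_nth_default (widen_ord nm b)) -?cardE ?cS // => /eqP.
  by rewrite nth_uniq ?enum_uniq -?cardE ?cS // => /eqP/val_inj.
- pose B := [set psi a | a : 'I_n]%SET.
  have BA : B \in A by rewrite inE card_imset // card_ord.
  exists (cast_ord cA (enum_rank_in BA B)) => a; apply: Sphi.
  by rewrite /S cast_ordK enum_rankK_in // imset_f.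
- apply: (@cast_ord_inj _ _ (esym cA)); apply: enum_val_inj; apply/eqP.
  rewrite eqEcard -/(S j) -/(S j') !cS leqnn andbT.
  apply/fintype.subsetP => x /Sphi[a ->].
  by have [b ->] := jj' a.
Qed.

Section AltcharInt.
Variables (R : realType) (m n N : nat) (phi : 'I_N -> 'I_n -> 'I_m).
Local Notation T := (circle R).
Local Notation X := (altchar R 'rV[int]_m n).

(** The Pluecker coordinates: maximal minors of the matrix with rows [w]. *)
Definition minors (w : {ffun 'I_n -> 'rV[int]_m}) j : int :=
  \det (\matrix_(a, b) w a 0 (phi j b)).

Definition minor_form (v : 'rV[T]_N) : cochain R 'rV[int]_m n := fun w =>
  \sum_j v 0 j *~ minors w j.

Lemma minor_form_altchar v : minor_form v \in altchars R 'rV[int]_m n.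
Proof.
apply/altcharsP; split=> [w i x y|w i j ij wij]; rewrite /minor_form.
  rewrite -big_split; apply: eq_bigr => j _ /=; rewrite -mulrzDr; congr (_ *~ _).
  rewrite /minors (@determinant_multilinear _ _ _
    (\matrix_(a, b) upd w i x a 0 (phi j b))
    (\matrix_(a, b) upd w i y a 0 (phi j b)) i 1 1) ?mul1r //; apply/matrixP => a b;
    by rewrite !mxE !ffunE ?eqxx ?mxE ?mul1r // eq_sym (negPf (neq_lift _ _)).
rewrite big1 // => k _; rewrite /minors (determinant_alternate ij) ?mulr0z // => b.
by rewrite !mxE wij.
Qed.

Definition altchar_of_coords v : X := Altchar (minor_form_altchar v).

Definition altchar_coords (x : X) : 'rV[T]_N :=
  \row_j altchar_val x (basis_args (phi j)).

Lemma altchar_coords_is_zmod_morphism : {morph altchar_coords : x y / x - y}.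
Proof. by move=> x y; apply/rowP => j; rewrite !mxE. Qed.

HB.instance Definition _ := GRing.isZmodMorphism.Build X 'rV[T]_N
  altchar_coords altchar_coords_is_zmod_morphism.

Lemma altchar_eval_continuous (w : {ffun 'I_n -> 'rV[int]_m}) :
  continuous (fun x : X => altchar_val x w : T).
Proof.
move=> x; apply: (@continuous_comp X {ptws {ffun 'I_n -> 'rV[int]_m} -> T} T
  (@altchar_val _ _ _) (@^~ w)); first exact: initial_continuous.
exact: eval_continuous.
Qed.

Lemma altchar_coords_continuous : continuous altchar_coords.
Proof.
apply: mx_continuous => i j.
rewrite (_ : (fun x => _) = fun x => altchar_val x (basis_args (phi j))).
  exact: altchar_eval_continuous.
by apply/funext => x; rewrite mxE.
Qed.

Lemma altchar_of_coords_continuous : continuous altchar_of_coords.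
Proof.
apply: (@continuous_comp_initial _ _ _
  (@altchar_val _ _ _ : X -> {ptws {ffun 'I_n -> 'rV[int]_m} -> T})) => v.
have FF := fmap_filter (@altchar_val _ _ _ \o altchar_of_coords) (nbhs_filter v).
apply/cvg_sup => w; move: v {FF}.
apply: (@continuous_comp_initial (cochain R 'rV[int]_m n) _ _ (@^~ w)).
rewrite (_ : _ \o _ = fun v : 'rV[T]_N => \sum_j v 0 j *~ minors w j) //.
apply: circle_continuous_sum => j; apply: circle_continuousMz.
exact: mx_entry_continuous.
Qed.

Hypotheses (phi_inj : forall j, injective (phi j))
  (phi_all : forall psi : 'I_n -> 'I_m, injective psi ->
    exists j, forall a, exists b, psi a = phi j b)
  (phi_diff : forall j j', (forall a, exists b, phi j a = phi j' b) -> j = j').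

(** For j = j' the matrix is the identity; otherwise some [phi j a] is outside the image of
    [phi j'], and row a vanishes. *)
Lemma minors_basis j j' : minors (basis_args (phi j)) j' = (j == j')%:R.
Proof.
rewrite /minors; case: eqVneq => [<-|jj'].
  rewrite (_ : \matrix_(_, _) _ = 1%:M) ?det1 //; apply/matrixP => a b.
  by rewrite !mxE ffunE mxE eqxx /= (inj_eq (@phi_inj j)) eq_sym.
have [a aE] : exists a, forall b, phi j a != phi j' b.
  apply: contrapT => /forallNP H; case/eqP: jj'; apply: phi_diff => a.
  by have /existsNP[b /negP/negPn/eqP] := H a; exists b.
rewrite (expand_det_row _ a) big1 // => b _.
by rewrite !mxE ffunE mxE eqxx /= eq_sym (negPf (aE b)) mul0r.
Qed.

Lemma altchar_of_coordsK : cancel altchar_of_coords altchar_coords.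
Proof.
move=> v; apply/rowP => j; rewrite mxE /= /minor_form (bigD1 j) //= big1 => [|k kj].
  by rewrite minors_basis eqxx addr0.
by rewrite minors_basis eq_sym (negPf kj) mulr0z.
Qed.

Lemma altchar_coordsK : cancel altchar_coords altchar_of_coords.
Proof.
move=> x; apply/eqP; rewrite -subr_eq0; apply/eqP/val_inj/funext => w.
have [cM cA] := altcharsP _ (altcharP (altchar_of_coords (altchar_coords x) - x)).
apply: (alternating_eq0 cM cA phi_all) => j.
have := congr1 (fun v : 'rV[T]_N => v 0 j) (altchar_of_coordsK (altchar_coords x)).
rewrite !mxE => E.
exact: etrans (congr1 (fun z => z - altchar_val x (basis_args (phi j))) E) (subrr _).
Qed.

End AltcharInt.

(** * Divisibility and compactness of the group of alternating multi-characters *)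

Section AltcharDivisible.
Variable R : realType.
Local Notation T := (circle R).

Lemma altchar_int_eq0 m n : (m < n)%N -> forall x : altchar R 'rV[int]_m n, x = 0.
Proof.
move=> mn x; apply/val_inj/funext => w.
have [cM cA] := altcharsP _ (altcharP x).
(* There is no injection of ['I_n] into ['I_m], so the empty family of enumerations suffices. *)
apply: (@alternating_eq0 _ _ _ _ void (fun v => match v with end) cM cA)
  => [psi psi_inj|[]].
by have := leq_card psi psi_inj; rewrite !card_ord leqNgt mn.
Qed.

Lemma pullback_altchars (Q Q' : zmodType) (phi : {additive Q -> Q'}) n
    (c : cochain R Q' n) :
  c \in altchars R Q' n -> pullback phi c \in altchars R Q n.
Proof.
move=> /altcharsP[cM cA]; apply/altcharsP; split=> [g i x y|g i j ij gij].
  have updE z : map_args phi (upd g i z) = upd (map_args phi g) i (phi z).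
    by apply/ffunP => j; rewrite !ffunE; case: ifP.
  by rewrite /pullback !updE raddfD cM.
by apply: (cA _ _ _ ij); rewrite !ffunE gij.
Qed.

Lemma altchar_valMn (Q : zmodType) n (x : altchar R Q n) N :
  altchar_val (x *+ N) = altchar_val x *+ N.
Proof. by elim: N => // N IH; rewrite !mulrS -IH. Qed.

Lemma cochainMnE (Q : zmodType) n (c : cochain R Q n) N g : (c *+ N) g = c g *+ N.
Proof. by elim: N => // N IH; rewrite !mulrS -IH. Qed.

(** For n <= m roots are taken coordinatewise in a torus; otherwise the group is trivial. *)
Lemma altchar_int_divisible m n (x : altchar R 'rV[int]_m n) N : (0 < N)%N ->
  exists y, y *+ N = x.
Proof.
move=> N0; have [nm|mn] := leqP n m; last first.
  by exists 0; rewrite (altchar_int_eq0 mn x) mul0rn.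
have [phi [phi_inj phi_all phi_diff]] := subset_enumerations nm.
have /choice[v vE] j := circle_divisible (altchar_coords phi x 0 j) N0.
exists (altchar_of_coords phi (\row_j v j)).
apply: (can_inj (altchar_coordsK phi_inj phi_all phi_diff)).
rewrite raddfMn /= (altchar_of_coordsK phi_inj phi_diff).
by apply/rowP => j; rewrite mulmxnE mxE vE.
Qed.

Section Multicharacters.
Variables (Q : zmodType) (n : nat).
Local Notation args := {ffun 'I_n -> Q}.

(** The defining equations of an alternating multi-character, one closed condition per index:
    additivity on the left, alternation on the right. *)
Definition altchar_holds (j : args * 'I_n * Q * Q + args * 'I_n * 'I_n) :
    set {ptws args -> T} :=
  match j with
  | inl (g, i, x, y) => [set c | c (upd g i (x + y)) - c (upd g i x) - c (upd g i y) = 0]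
  | inr (g, i, j) => if (i != j) && (g i == g j) then [set c | c g = 0] else setT
  end.

Lemma altchar_holds_closed j : closed (altchar_holds j).
Proof.
case: j => [[[[g i] x] y]|[[g i] j]] /=; last first.
  case: ifP => _; last exact: closedT.
  by apply: circle_closed_eq; exact: eval_continuous.
apply: circle_closed_eq; apply: circle_continuousB; last exact: eval_continuous.
by apply: circle_continuousB; exact: eval_continuous.
Qed.

Lemma altchar_holdsP (c : cochain R Q n) :
  (forall j, altchar_holds j c) <-> c \in altchars R Q n.
Proof.
split=> [cH|/altcharsP[cM cA]].
  apply/altcharsP; split=> [g i x y|g i j ij gij].
    have /eqP := cH (inl (g, i, x, y)).
    by rewrite -addrA -opprD subr_eq0 => /eqP.
  by have := cH (inr (g, i, j)); rewrite /= ij gij eqxx.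
case=> [[[[g i] x] y]|[[g i] j]] /=; last first.
  by case: ifP => // /andP[ij /eqP gij]; exact: cA gij.
by rewrite cM -addrA -opprD subrr.
Qed.

(** The conditions [altchar_holds] are closed in a compact product, so a cluster point in the
    product is again a multi-character. *)
Lemma altchar_compact : compact [set: altchar R Q n].
Proof.
move=> F FF _.
have cT : compact [set: {ptws args -> T}].
  have := @tychonoff args (fun=> T) (fun=> setT) (fun=> @circle_compact R).
  by congr compact; apply/seteqP; split.
pose v := @altchar_val R Q n : altchar R Q n -> {ptws args -> T}.
have [c [_ Fc]] := cT (v @ F) _ filterT.
have cX : c \in altchars R Q n.
  apply/altchar_holdsP => j; apply: altchar_holds_closed => U nU.
  have vH x : altchar_holds j (v x) by have /altchar_holdsP/(_ j) := altcharP x.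
  have [] := Fc (altchar_holds j) U _ nU; last by move=> d ?; exists d.
  exact: (@filterE _ F _ (v @^-1` _) vH).
exists (Altchar cX); split=> // A B FA.
rewrite nbhsE => -[B' [[C oC <-] Cc] B'B].
have [||_ [[x Ax <-] Cx]] := Fc (v @` A) C.
- by apply: (@filterS _ F _ A (v @^-1` _)) FA => x Ax; exists x.
- by apply: open_nbhs_nbhs; split.
by exists x; split=> //; apply: B'B.
Qed.

Lemma altchar_divisible (c : cochain R Q n) N : torsion_free Q ->
  (0 < N)%N -> c \in altchars R Q n -> exists2 d, d \in altchars R Q n & d *+ N = c.
Proof.
move=> tfQ N0 cX.
(* Adds to the defining equations those of an N-th root of [c]. *)
pose E (j : args * 'I_n * Q * Q + args * 'I_n * 'I_n + args) : set {ptws args -> T} :=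
  match j with
  | inl j => altchar_holds j
  | inr g => [set d | d g *+ N = c g]
  end.
suff [d dE] : exists d, forall j, E j d.
  exists d; first by apply/altchar_holdsP => j; exact: (dE (inl j)).
  by apply/funext => g; rewrite cochainMnE; exact: (dE (inr g)).
apply: finitely_solvable => [[j|g]|s]; first exact: altchar_holds_closed.
  by apply: circle_closed_eq; apply: circle_continuousMn; exact: eval_continuous.
(* The elements of [Q] occurring in an equation; their sums lie in the image of [f] by
   additivity. *)
pose entries (j : args * 'I_n * Q * Q + args * 'I_n * 'I_n + args) : seq Q :=
  match j with
  | inl (inl (g, _, x, y)) => [:: x, y & codom g]
  | inl (inr (g, _, _)) => codom g
  | inr g => codom g
  end.
have [m [f [finj fs]]] := free_subgroup tfQ (flatten [seq entries j | j <- s]).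
have [y yN] : exists y : altchar R 'rV[int]_m n, altchar_val y *+ N = pullback f c.
  have [y yN] := altchar_int_divisible (Altchar (pullback_altchars f cX)) N0.
  by exists y; rewrite -altchar_valMn yN.
have [yM yA] := altcharsP _ (altcharP y).
pose lift (g : args) : {ffun 'I_n -> 'rV[int]_m} := [ffun i => preimage_or0 f (g i)].
have fK x : x \in flatten [seq entries j | j <- s] -> f (preimage_or0 f x) = x.
  by move=> xs; apply: preimage_or0_im; exact: fs.
exists (fun g => altchar_val y (lift g)) => j js.
have {}fK x : x \in entries j -> f (preimage_or0 f x) = x.
  by move=> xj; apply: fK; apply/flattenP; exists (entries j) => //; exact: map_f.
case: j fK {js} => [[[[[g i] a] b]|[[g i] j]]|g] fK /=.
- have updE z : lift (upd g i z) = upd (lift g) i (preimage_or0 f z).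
    by apply/ffunP => k; rewrite !ffunE; case: ifP.
  have -> : lift (upd g i (a + b)) = upd (lift g) i (preimage_or0 f a + preimage_or0 f b).
    rewrite updE; congr upd; rewrite -[RHS](preimage_or0K finj) raddfD.
    by rewrite !fK ?inE ?eqxx ?orbT.
  by rewrite yM !updE -addrA -opprD subrr.
- case: ifP => // /andP[ij /eqP gij]; apply: (yA _ _ _ ij).
  by rewrite !ffunE gij.
- rewrite -cochainMnE yN; congr (c _); apply/ffunP => i.
  by rewrite !ffunE fK //; exact: codom_f.
Qed.

End Multicharacters.
End AltcharDivisible.

(** * Characters of the exterior power *)

Section ExteriorLift.
Variables (Q : zmodType) (n : nat).
Local Notation args := {ffun 'I_n -> Q}.
Local Notation freeQ := {freeg args / int}.

Lemma freeg_morph_ext (V : zmodType) (A B : freeQ -> V) :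
  {morph A : u v / u - v} -> {morph B : u v / u - v} ->
  (forall g, A << g >> = B << g >>) -> A =1 B.
Proof.
move=> AB BB AgB u.
pose D v := A v - B v.
have DB : {morph D : u v / u - v}.
  by move=> v w; rewrite /D AB BB; zmod_eq.
have D0 : D 0 = 0 by rewrite -(subrr (0 : freeQ)) DB subrr.
have DN v : D (- v) = - D v by rewrite -[- v]sub0r DB D0 sub0r.
have DD : {morph D : u v / u + v} by move=> v w; rewrite -[w in LHS]opprK DB DN opprK.
suff : D u = 0 by move=> /eqP; rewrite subr_eq0 => /eqP.
rewrite -(freeg_sumE u) (big_morph D DD D0) big1 // => g _.
have Dg : D << g >> = 0 by rewrite /D AgB subrr.
rewrite -[coeff g u]intz -freegU_mulz; elim/int_rec: (coeff g u) => [|k IH|k IH].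
- by rewrite mulr0z.
- by rewrite -pmulrn mulrSr DD pmulrn IH Dg addr0.
- by rewrite mulrNz -pmulrn mulrSr opprD DD pmulrn -mulrNz IH DN Dg oppr0 addr0.
Qed.

Variables (R : realType) (c : cochain R Q n).

(** [zmodule] makes the circle a module over [int], as [fglift] requires. *)
Definition ext_lift (u : freeQ) : circle R := fglift (c : args -> zmodule (circle R)) u.

Lemma ext_liftB : {morph ext_lift : u v / u - v}.
Proof.
exact: (@lift_is_additive int _ (zmodule (circle R)) c).
Qed.

Lemma ext_liftU g : ext_lift << g >> = c g.
Proof. by rewrite /ext_lift liftU scale1r. Qed.

Hypothesis cX : c \in altchars R Q n.

Lemma ext_lift_relator u : u \in spanZ (@ext_relator Q n) -> ext_lift u = 0.
Proof.
have l0 : ext_lift 0 = 0 by rewrite -(subrr (0 : freeQ)) ext_liftB subrr.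
have [cM cA] := altcharsP _ cX.
move=> /spanZP/(_ [pred v | ext_lift v == 0]) H; apply/eqP; apply: H.
  split=> [|v w]; rewrite ![_ \in [pred _ | _]]unfold_in /= ?l0 // ext_liftB.
  by move=> /eqP -> /eqP ->; rewrite subrr.
move=> _ [g i x y|g i j ij gij]; rewrite [_ \in [pred _ | _]]unfold_in /=.
  by rewrite !ext_liftB !ext_liftU cM -addrA -opprD subrr.
by rewrite ext_liftU (cA _ _ _ ij gij).
Qed.

(** The choice of representative is immaterial, since [ext_lift] kills the relators. *)
Definition ext_char_fun (w : extpower Q n) : circle R := ext_lift (repr w).

Lemma ext_char_class u : ext_char_fun (ext_class u) = ext_lift u.
Proof.
apply/eqP; rewrite -subr_eq0 -ext_liftB; apply/eqP/ext_lift_relator.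
by rewrite Quotient.idealrBE; apply/eqP; exact: reprK.
Qed.

Lemma ext_classB : {morph @ext_class Q n : u v / u - v}.
Proof. by move=> u v; rewrite /ext_class raddfB. Qed.

Lemma ext_class_repr (w : extpower Q n) : ext_class (repr w) = w.
Proof. exact: reprK. Qed.

Lemma ext_charB : {morph ext_char_fun : x y / x - y}.
Proof.
move=> x y; rewrite -(ext_class_repr x) -(ext_class_repr y) -ext_classB.
by rewrite !ext_char_class ext_liftB.
Qed.

Lemma ext_char_character : ext_char_fun \in @characters R (extpower Q n).
Proof.
apply/charactersP => x y.
have e0 : ext_char_fun 0 = 0 by rewrite -(subrr (0 : extpower Q n)) ext_charB subrr.
by rewrite -[y in LHS]opprK ext_charB -[- y]sub0r ext_charB e0 sub0r opprK.
Qed.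

Definition ext_char : dual R (extpower Q n) := Dual ext_char_character.

Lemma ext_char_wedge g : ext_char (wedge g) = c g.
Proof. by rewrite /= /wedge ext_char_class ext_liftU. Qed.

End ExteriorLift.

Section CharactersOfExteriorPower.
Variables (R : realType) (Q : zmodType) (n : nat).

Lemma ext_morph_ext (V : zmodType) (A B : extpower Q n -> V) :
  {morph A : u v / u - v} -> {morph B : u v / u - v} ->
  (forall g, A (wedge g) = B (wedge g)) -> A =1 B.
Proof.
move=> AB BB AgB w; rewrite -(ext_class_repr w).
apply: (@freeg_morph_ext _ _ _ (A \o @ext_class Q n) (B \o @ext_class Q n)) => // u v /=.
  by rewrite ext_classB AB.
by rewrite ext_classB BB.
Qed.

Lemma dualB (A : zmodType) (chi : dual R A) : {morph chi : u v / u - v}.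
Proof.
have /charactersP chiD := dualP chi.
move=> u v; apply: (addIr (chi v)); rewrite -chiD !subrK //.
Qed.

(** Provides the inverse of [ext_char]: the relators say that [wedge] is multiadditive and
    alternating. *)
Lemma wedge_altchar (chi : dual R (extpower Q n)) :
  (fun g => chi (wedge g)) \in altchars R Q n.
Proof.
have /charactersP chiD := dualP chi.
apply/altcharsP; split=> [g i x y|g i j ij gij].
  rewrite -chiD; congr (chi _); apply/eqP; rewrite /wedge.
  rewrite -[ext_class _ + _]raddfD -Quotient.idealrBE opprD addrA.
  apply/spanZP => P _; apply.
  exact: ext_relator_add.
have -> : wedge g = 0.
  apply/eqP; rewrite /wedge -[0](raddf0 (\pi_(Quotient.quot (spanZ (@ext_relator Q n))))).
  rewrite -Quotient.idealrBE subr0; apply/spanZP => P _; apply.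
  exact: ext_relator_alt ij gij.
by rewrite -(subrr (0 : extpower Q n)) dualB subrr.
Qed.

End CharactersOfExteriorPower.

(** * From cohomology classes to multi-characters and characters *)

Section CohomologyAltchar.
Variables (R : realType) (Q : zmodType) (n : nat).
Local Notation H := (cohomology R Q n).
Local Notation X := (altchar R Q n).

Lemma cohomology_class_repr (x : H) : cohomology_class (repr x) = x.
Proof. exact: reprK. Qed.

Lemma cohomology_class_eq (c d : cocycle R Q n) :
  cohomology_class c = cohomology_class d <->
  cocycle_val c - cocycle_val d \in coboundaries R Q n.
Proof.
split=> [/eqP|cd]; first by rewrite -Quotient.idealrBE.
by apply/eqP; rewrite -Quotient.idealrBE.
Qed.

Lemma cohomology_classB (c d : cocycle R Q n) :
  cohomology_class (c - d) = cohomology_class c - cohomology_class d.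
Proof. by rewrite /cohomology_class raddfB. Qed.

(** Independent of the representative, as [AS] kills coboundaries. *)
Definition AS_class (x : H) : X := Altchar (AS_altchar (cocycleP (repr x))).

Lemma AS_classE (c : cocycle R Q n) :
  altchar_val (AS_class (cohomology_class c)) = AS c.
Proof.
have /cohomology_class_eq/AS_coboundary := cohomology_class_repr (cohomology_class c).
by rewrite raddfB => /eqP; rewrite subr_eq0 => /eqP.
Qed.

Lemma AS_class_is_zmod_morphism : {morph AS_class : x y / x - y}.
Proof.
move=> x y; rewrite -(cohomology_class_repr x) -(cohomology_class_repr y).
rewrite -cohomology_classB; apply: val_inj.
rewrite [RHS]raddfB [LHS]AS_classE !raddfB.
by congr (_ - _); rewrite [RHS]AS_classE.
Qed.

HB.instance Definition _ := GRing.isZmodMorphism.Build H X AS_class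
  AS_class_is_zmod_morphism.

Hypothesis tfQ : torsion_free Q.

(** [d] is a root of [c] of order n!, and [AS] raises [d] to the power n!. *)
Lemma altchars_AS (c : cochain R Q n) : c \in altchars R Q n ->
  exists2 d, d \in altchars R Q n & AS d = c.
Proof.
move=> cX; have [d dX dc] := altchar_divisible tfQ (fact_gt0 n) cX.
by exists d; rewrite ?AS_altcharE.
Qed.

(** Injective by exactness; surjective because each alternating multi-character is [AS] of another
    one, which is a cocycle. *)
Lemma AS_class_bij : bijective AS_class.
Proof.
have inj : injective AS_class.
  move=> x y; rewrite -(cohomology_class_repr x) -(cohomology_class_repr y).
  move=> /(congr1 (@altchar_val R Q n)); rewrite !AS_classE => E.
  apply/cohomology_class_eq/AS_exact_torsion_free => //.
    by rewrite rpredB //; exact: cocycleP.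
  by rewrite raddfB /= E subrr.
have surj (y : X) : exists x, AS_class x = y.
  have [d dX dy] := altchars_AS (altcharP y).
  exists (cohomology_class (Cocycle (altchars_sub_cocycles dX))).
  by apply: val_inj; rewrite [LHS]AS_classE.
have [g gK] := choice surj.
by exists g => // x; apply: inj; rewrite gK.
Qed.

End CohomologyAltchar.

Section CohomologyDual.
Variables (R : realType) (Q : zmodType) (n : nat).
Local Notation H := (cohomology R Q n).
Local Notation D := (dual R (extpower Q n)).

Definition dual_of_class (x : H) : D := ext_char (altcharP (AS_class x)).

Lemma dual_ext (chi psi : D) :
  (forall g, chi (wedge g) = psi (wedge g)) -> chi = psi.
Proof.
move=> E; apply/val_inj/funext.
by apply: ext_morph_ext => //; exact: dualB.
Qed.

Lemma dual_of_class_wedge x g : dual_of_class x (wedge g) = altchar_val (AS_class x) g.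
Proof. exact: ext_char_wedge. Qed.

Lemma dual_of_class_is_zmod_morphism : {morph dual_of_class : x y / x - y}.
Proof.
move=> x y; apply: dual_ext => g.
rewrite dual_of_class_wedge raddfB.
by congr (_ - _); apply: esym; exact: dual_of_class_wedge.
Qed.

HB.instance Definition _ := GRing.isZmodMorphism.Build H D dual_of_class
  dual_of_class_is_zmod_morphism.

Lemma dual_of_class_bij : torsion_free Q -> bijective dual_of_class.
Proof.
move=> tfQ; have [s sK Ks] := AS_class_bij R n tfQ.
exists (fun chi => s (Altchar (wedge_altchar chi))) => [x|chi].
  rewrite -[RHS]sK; congr s; apply/val_inj/funext => g.
  exact: dual_of_class_wedge.
by apply: dual_ext => g; rewrite dual_of_class_wedge Ks.
Qed.

End CohomologyDual.

(** Both sides are additive in [w], and on wedges the claim is that [AS] commutes with pullback. *)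
Lemma dual_of_class_natural (R : realType) (Q Q' : zmodType)
    (phi : {additive Q -> Q'}) n (x : cohomology R Q' n) (w : extpower Q n) :
  dual_of_class (cohomology_map phi x) w = dual_of_class x (ext_map phi w).
Proof.
move: w; apply: ext_morph_ext => [|u v|g]; first exact: dualB.
  rewrite -(ext_class_repr u) -(ext_class_repr v) -ext_classB !ext_map_class.
  by rewrite raddfB ext_classB dualB.
rewrite ext_map_wedge !dual_of_class_wedge -(cohomology_class_repr x).
by rewrite cohomology_map_class !AS_classE AS_pullback.
Qed.

Lemma torsion_free_rV m : torsion_free 'rV[int]_m.
Proof.
move=> v k k0 vk; apply/rowP => j; have := congr1 (fun u : 'rV_m => u 0 j) vk.
by rewrite mulmxnE !mxE => /eqP; rewrite mulrn_eq0 eqn0Ngt k0 => /eqP.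
Qed.

Lemma altchar_int_iso (R : realType) m n : (0 < n)%N -> (n <= m)%N ->
  exists (f : {additive altchar R 'rV[int]_m n ->
                 'rV[circle R]_(m`! %/ (n`! * (m - n)`!))})
         (g : 'rV[circle R]_(m`! %/ (n`! * (m - n)`!)) -> altchar R 'rV[int]_m n),
    [/\ cancel f g, cancel g f, continuous f & continuous g].
Proof.
(* The quotient of factorials is a binomial coefficient; the side condition [0 < m] comes from [n0]
   and [nm]. *)
move=> n0 nm; rewrite -bin_factd ?(leq_trans n0) //.
have [phi [phi_inj phi_all phi_diff]] := subset_enumerations nm.
exists (@altchar_coords R m n _ phi), (@altchar_of_coords R m n _ phi); split.
- exact: altchar_coordsK.
- exact: altchar_of_coordsK.
- exact: altchar_coords_continuous.
- exact: altchar_of_coords_continuous.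
Qed.

(** * The theorem *)

Section ExactSequence.
Variables (R : realType) (Q : zmodType) (n : nat).
Hypothesis tfQ : torsion_free Q.

Lemma AS_image : AS @` [set` cocycles R Q n] = [set` altchars R Q n].
Proof.
apply/seteqP; split=> [_ [c cZ <-]|x xX]; first exact: AS_altchar.
have [d dX dx] := altchars_AS tfQ xX.
by exists d => //; exact: altchars_sub_cocycles.
Qed.

Lemma coboundaries_ker :
  [set` coboundaries R Q n] = [set c | c \in cocycles R Q n /\ AS c = 0].
Proof.
apply/seteqP; split=> [c cB|c [cZ c0]]; last exact: AS_exact_torsion_free.
by split; [exact: coboundaries_sub_cocycles|exact: AS_coboundary].
Qed.

Lemma cocycles_sum : [set` cocycles R Q n] =
  [set x + b | x in [set` altchars R Q n] & b in [set` coboundaries R Q n]].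
Proof.
apply/seteqP; split=> [c cZ|_ [x xX [b bB <-]]]; last first.
  exact: rpredD (altchars_sub_cocycles xX) (coboundaries_sub_cocycles bB).
(* [d] is a multi-character with the same asymmetrization as [c], so [c - d] lies in the kernel of
   [AS]. *)
have [d dX dc] := altchars_AS tfQ (AS_altchar cZ).
exists d => //; exists (c - d); last by rewrite addrC subrK.
apply: AS_exact_torsion_free => //.
  by rewrite rpredB //; exact: altchars_sub_cocycles.
by rewrite raddfB /= dc subrr.
Qed.

(** On multi-characters [AS] is the power n!, and its kernel on cocycles consists of the
    coboundaries. *)
Lemma altchars_coboundaries :
  [set` altchars R Q n] `&` [set` coboundaries R Q n] =
  [set c | c \in altchars R Q n /\ c *+ n`! = 0].
Proof.
apply/seteqP; split=> [c [cX cB]|c [cX c0]]; split=> //.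
  by rewrite -AS_altcharE // AS_coboundary.
apply: AS_exact_torsion_free => //; first exact: altchars_sub_cocycles.
by rewrite AS_altcharE.
Qed.

End ExactSequence.

Theorem theorem2p6 (R : realType) (n : nat) (n_gt0 : (0 < n)%N) :
  (forall Q : zmodType, countable [set: Q] -> torsion_free Q ->
    [/\ (* (i) *)
        (AS @` [set` cocycles R Q n] = [set` altchars R Q n]
         /\ compact [set: altchar R Q n]),
        (* (ii), exactness *)
        [/\ {subset coboundaries R Q n <= cocycles R Q n},
            [set` coboundaries R Q n] =
              [set c | c \in cocycles R Q n /\ AS c = 0]
          & AS @` [set` cocycles R Q n] = [set` altchars R Q n]]
      & (* (iii) *)
        [/\ zmod_closed (altchars R Q n)
            /\ {subset altchars R Q n <= cocycles R Q n},
            [set` cocycles R Q n] =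
              [set x + b | x in [set` altchars R Q n]
                         & b in [set` coboundaries R Q n]],
            [set` altchars R Q n] `&` [set` coboundaries R Q n] =
              [set c | c \in altchars R Q n /\ c *+ n`! = 0]
          & forall c, c \in altchars R Q n -> AS c = c *+ n`!]])
  /\ (* (ii), the groups Z^m *)
  (forall m : nat,
    [/\ (exists f : {additive cohomology R 'rV[int]_m n ->
                              altchar R 'rV[int]_m n},
           bijective f /\
           forall c : cocycle R 'rV[int]_m n,
             altchar_val (f (cohomology_class c)) = AS c),
        ((n <= m)%N ->
          exists (f : {additive altchar R 'rV[int]_m n ->
                         'rV[circle R]_(m`! %/ (n`! * (m - n)`!))})
                 (g : 'rV[circle R]_(m`! %/ (n`! * (m - n)`!)) ->
                      altchar R 'rV[int]_m n),
            [/\ cancel f g, cancel g f, continuous f & continuous g])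
      & ((m < n)%N -> forall x : altchar R 'rV[int]_m n, x = 0)])
  /\ (* (ii), natural isomorphism with the dual of the exterior power *)
  (exists Phi : forall Q : zmodType,
      {additive cohomology R Q n -> dual R (extpower Q n)},
    (forall Q : zmodType, countable [set: Q] -> torsion_free Q ->
       bijective (Phi Q) /\
       forall (c : cocycle R Q n) (g : {ffun 'I_n -> Q}),
         Phi Q (cohomology_class c) (wedge g) = AS c g)
    /\
    (forall Q Q' : zmodType,
       countable [set: Q] -> torsion_free Q ->
       countable [set: Q'] -> torsion_free Q' ->
       forall (phi : {additive Q -> Q'})
              (x : cohomology R Q' n) (w : extpower Q n),
         Phi Q (cohomology_map phi x) w = Phi Q' x (ext_map phi w))).
Proof.
split=> [Q _ tfQ|].
  split; [|split|split].
  - by split; [exact: AS_image|exact: altchar_compact].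
  - exact: coboundaries_sub_cocycles.
  - exact: coboundaries_ker.
  - exact: AS_image.
  - by split; [exact: altchars_zmod_closed|exact: altchars_sub_cocycles].
  - exact: cocycles_sum.
  - exact: altchars_coboundaries.
  - exact: AS_altcharE.
split=> [m|].
  split; [|exact: altchar_int_iso|exact: altchar_int_eq0].
  exists (@AS_class R 'rV[int]_m n); split=> [|c]; last exact: AS_classE.
  exact/AS_class_bij/torsion_free_rV.
exists (fun Q => @dual_of_class R Q n); split=> [Q _ tfQ|Q Q' _ _ _ _ phi x w].
  split=> [|c g]; first exact: dual_of_class_bij.
  by rewrite [LHS]dual_of_class_wedge AS_classE.
exact: dual_of_class_natural.
Qed.
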